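(* Let $G$ be an abelian group, $\mathbb{F}$ a field, $\mathcal{D}$ a $G$-graded associative $\mathbb{F}$-algebra which is a graded-division algebra, with grading $\Gamma_0$ and support $T$, and $\mathcal{V}$ a nonzero $G$-graded right $\mathcal{D}$-module of finite dimension $k$ over $\mathcal{D}$. Let $\Gamma$ be the induced $G$-grading on $\mathcal{R}=\operatorname{End}_{\mathcal{D}}(\mathcal{V})$. Assume that $(\mathcal{D},\mathcal{V})$ satisfies the fine condition. Then the Weyl group of $\Gamma$ is isomorphic to $$W(\Gamma)\cong T^{k-1}\rtimes(\operatorname{Sym}(k)\times W(\Gamma_0)).$$ In this semidirect product, $T^{k-1}$ is identified with $T^k/T$, where $T$ is embedded into $T^k$ diagonally; $W(\Gamma_0)$ acts on $T^k$ componentwise, and $\pi\in\operatorname{Sym}(k)$ acts on $(t_1,\dots,t_k)\in T^k$ by $\pi(t_1,\dots,t_k)=(t_{\pi^{-1}(1)},\dots,t_{\pi^{-1}(k)})$.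
   Context: A graded-division algebra is a (nonzero) unital graded associative algebra in which every nonzero homogeneous element is invertible; its support $T=\{g\in G\mid\mathcal{D}_g\neq0\}$ is a subgroup of $G$. A $G$-graded right $\mathcal{D}$-module is $\mathcal{V}=\bigoplus_{g\in G}\mathcal{V}_g$ with $\mathcal{V}_g\mathcal{D}_h\subseteq\mathcal{V}_{gh}$; it is free with a homogeneous $\mathcal{D}$-basis. $\operatorname{End}_{\mathcal{D}}(\mathcal{V})$ is graded by: $r$ has degree $g$ if $r\mathcal{V}_h\subseteq\mathcal{V}_{gh}$ for all $h\in G$. The isotypic components of $\mathcal{V}$ are the nonzero subspaces among $\bigoplus_{h\in gT}\mathcal{V}_h$, $gT\in G/T$; let $g_1T,\dots,g_sT$ be their (distinct) supports and $k_1,\dots,k_s$ their $\mathcal{D}$-dimensions, so $k=k_1+\dots+k_s$. The pair $(\mathcal{D},\mathcal{V})$ satisfies the fine condition if $k_1=\dots=k_s=1$ and $g_ig_j^{-1}\not\equiv g_hg_\ell^{-1}\pmod T$ for all $i\neq j$ and $(i,j)\neq(h,\ell)$. For a grading $\Gamma$ on an $\mathbb{F}$-algebra $\mathcal{R}$: $\operatorname{Aut}(\Gamma)$ is the group of self-equivalences, i.e. of $\mathbb{F}$-algebra automorphisms of $\mathcal{R}$ that map each homogeneous component onto a homogeneous component; $\operatorname{Stab}(\Gamma)$ is the normal subgroup of those mapping each homogeneous component onto itself; the Weyl group is $W(\Gamma)=\operatorname{Aut}(\Gamma)/\operatorname{Stab}(\Gamma)$. Similarly for $\Gamma_0$ on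 $\mathcal{D}$. The group $W(\Gamma_0)$ acts on $T$ by group automorphisms: the class of $\psi_0\in\operatorname{Aut}(\Gamma_0)$ sends $t$ to the element $t'$ with $\psi_0(\mathcal{D}_t)=\mathcal{D}_{t'}$. $\operatorname{Sym}(k)$ is the symmetric group of degree $k$. *)

(* Defs.v *)
From HB Require Import structures.
From mathcomp Require Import all_boot fingroup perm all_algebra generic_quotient.
From mathcomp Require Import boolp classical_sets.

Set Implicit Arguments.
Unset Strict Implicit.
Unset Printing Implicit Defensive.

Import GRing.Theory.
Local Open Scope classical_set_scope.
Local Open Scope ring_scope.

Definition isomorphic (G H : groupType) : Prop :=
  exists f : {multiplicative G -> H}, bijective f.

Record normal_subgroup (G : groupType) := NormalSubgroup {
  nsub :> {pred G};
  nsub_closed : group_closed nsub;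
  nsub_norm : forall x y : G, x \in nsub -> (x ^ y)%g \in nsub
}.

Section QuotientGroup.
Local Open Scope group_scope.
Variables (G : groupType) (N : normal_subgroup G).

Let N1 : 1 \in N. Proof. exact: (nsub_closed N).1. Qed.
Let NF x y : x \in N -> y \in N -> x / y \in N.
Proof. exact: (nsub_closed N).2. Qed.
Let NV x : x \in N -> x^-1 \in N.
Proof. by move=> Nx; rewrite -[x^-1]mul1g NF. Qed.
Let NM x y : x \in N -> y \in N -> x * y \in N.
Proof. by move=> Nx /NV/(NF Nx); rewrite invgK. Qed.

Definition coset_rel : rel G := fun x y => x^-1 * y \in N.

Lemma coset_rel_refl : reflexive coset_rel.
Proof. by move=> x; rewrite /coset_rel mulVg. Qed.
Lemma coset_rel_sym : symmetric coset_rel.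
Proof.
move=> x y; rewrite /coset_rel.
by apply/idP/idP => /NV; rewrite invgM invgK.
Qed.
Lemma coset_rel_trans : transitive coset_rel.
Proof.
move=> y x z; rewrite /coset_rel => xy yz.
by have := NM xy yz; rewrite mulgA mulgK.
Qed.

Canonical coset_equiv :=
  EquivRel coset_rel coset_rel_refl coset_rel_sym coset_rel_trans.

Definition quotient_group := {eq_quot coset_equiv}%qT.

HB.instance Definition _ := Choice.on quotient_group.
HB.instance Definition _ := Quotient.on quotient_group.

Local Notation pi := (\pi_quotient_group%qT).

Lemma coset_eqP x y : (pi x = pi y) <-> x^-1 * y \in N.
Proof. by split=> [/eqmodP|H]; [|apply/eqmodP]. Qed.

Definition quot_mul (p q : quotient_group) : quotient_group :=
  pi (repr p * repr q).
Definition quot_inv (p : quotient_group) : quotient_group := pi (repr p)^-1.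

Lemma pi_repr (x : G) : (repr (pi x))^-1 * x \in N.
Proof. by apply/coset_eqP; rewrite reprK. Qed.

Lemma pi_mul x y : quot_mul (pi x) (pi y) = pi (x * y).
Proof.
apply/coset_eqP; have hx := pi_repr x; have hy := pi_repr y.
set a := repr (pi x) in hx *; set b := repr (pi y) in hy *.
have -> : (a * b)^-1 * (x * y) = ((a^-1 * x) ^ b) * (b^-1 * y).
  by rewrite /conjg invgM !mulgA mulgK.
by apply: NM => //; apply: nsub_norm.
Qed.

Lemma pi_inv x : quot_inv (pi x) = pi x^-1.
Proof.
apply/coset_eqP; have hx := pi_repr x; set a := repr (pi x) in hx *.
have -> : a^-1^-1 * x^-1 = (a^-1 * x)^-1 ^ a^-1.
  by rewrite /conjg invgM !invgK !mulgA mulgK.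
by apply: nsub_norm; apply: NV.
Qed.

Lemma quot_mulA : associative quot_mul.
Proof.
elim/quotW=> x; elim/quotW=> y; elim/quotW=> z.
by rewrite (pi_mul y z) (pi_mul x) (pi_mul x y) (pi_mul _ z) mulgA.
Qed.
Lemma quot_mul1 : left_id (pi 1) quot_mul.
Proof. by elim/quotW=> x; rewrite pi_mul mul1g. Qed.
Lemma quot_mul1r : right_id (pi 1) quot_mul.
Proof. by elim/quotW=> x; rewrite pi_mul mulg1. Qed.
Lemma quot_mulV : left_inverse (pi 1) quot_inv quot_mul.
Proof. by elim/quotW=> x; rewrite pi_inv pi_mul mulVg. Qed.
Lemma quot_mulVr : right_inverse (pi 1) quot_inv quot_mul.
Proof. by elim/quotW=> x; rewrite pi_inv pi_mul mulgV. Qed.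

HB.instance Definition _ := isGroup.Build quotient_group
  quot_mulA quot_mul1 quot_mul1r quot_mulV quot_mulVr.

End QuotientGroup.

(* a left action of H on N by group automorphisms *)
Record group_action (H N : groupType) := GroupAction {
  gact :> H -> N -> N;
  gact1 : forall n, gact 1%g n = n;
  gactM : forall h h' n, gact (h * h')%g n = gact h (gact h' n);
  gact_morph : forall h, {morph gact h : n n' / (n * n')%g}
}.

Section SemidirectProduct.
Local Open Scope group_scope.
Variables (N H : groupType) (a : group_action H N).

Definition sdprod_group (_ : group_action H N) : Type := (N * H)%type.
Local Notation sd := (sdprod_group a).
HB.instance Definition _ := Choice.on sd.

Implicit Types p q : sd.
Definition sd_one : sd := (1, 1).
Definition sd_mul p q : sd := (p.1 * a p.2 q.1, p.2 * q.2).
Definition sd_inv p : sd := (a p.2^-1 p.1^-1, p.2^-1).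

Let act1 h : a h 1 = 1.
Proof. by apply: (mulgI (a h 1)); rewrite -gact_morph !mulg1. Qed.

Lemma sd_mulA : associative sd_mul.
Proof. by move=> p q r; rewrite /sd_mul /= gact_morph gactM !mulgA. Qed.
Lemma sd_mul1 : left_id sd_one sd_mul.
Proof. by case=> n h; rewrite /sd_mul /= gact1 !mul1g. Qed.
Lemma sd_mul1r : right_id sd_one sd_mul.
Proof. by case=> n h; rewrite /sd_mul /= act1 !mulg1. Qed.
Lemma sd_mulV : left_inverse sd_one sd_inv sd_mul.
Proof.
by case=> n h; rewrite /sd_mul /= -gact_morph !mulVg act1.
Qed.
Lemma sd_mulVr : right_inverse sd_one sd_inv sd_mul.
Proof.
by case=> n h; rewrite /sd_mul /= -gactM !mulgV gact1 mulgV.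
Qed.

HB.instance Definition _ := isGroup.Build sd
  sd_mulA sd_mul1 sd_mul1r sd_mulV sd_mulVr.

End SemidirectProduct.

Section QuotientAction.
Local Open Scope group_scope.
Variables (H N : groupType) (a : group_action H N) (M : normal_subgroup N).
Hypothesis stableM : forall h n, n \in M -> a h n \in M.

Local Notation pi := (\pi_(quotient_group M)%qT).

Definition quot_act (h : H) (q : quotient_group M) : quotient_group M :=
  pi (a h (repr q)).

Lemma quot_act_pi h n : quot_act h (pi n) = pi (a h n).
Proof.
apply/coset_eqP; have /(stableM h) := pi_repr M n.
set r := repr _; suff -> : a h (r^-1 * n) = (a h r)^-1 * a h n by [].
by apply: (mulgI (a h r)); rewrite -gact_morph !mulVKg.
Qed.

Lemma quot_act1 q : quot_act 1 q = q.
Proof. by elim/quotW: q => n; rewrite quot_act_pi gact1. Qed.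
Lemma quot_actM h h' q : quot_act (h * h') q = quot_act h (quot_act h' q).
Proof. by elim/quotW: q => n; rewrite (quot_act_pi h') !quot_act_pi gactM. Qed.
Lemma quot_act_morph h : {morph quot_act h : p q / p * q}.
Proof.
elim/quotW=> m; elim/quotW=> n.
rewrite (quot_act_pi h m) (quot_act_pi h n).
rewrite [(_ * _ in LHS)](pi_mul M m n) [RHS](pi_mul M) quot_act_pi.
by rewrite gact_morph.
Qed.

Definition quotient_action : group_action H (quotient_group M) :=
  GroupAction quot_act1 quot_actM quot_act_morph.

End QuotientAction.

(* The library's product on 'S_k is (s * t) i = t (s i); here products are
   composed as functions, (s * t) i = s (t i). *)
Definition sym_group (k : nat) : Type := 'S_k.

Section sym_group.
Local Open Scope group_scope.
Variable k : nat.

HB.instance Definition _ := Choice.on (sym_group k).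

Definition sym_mul (s t : sym_group k) : sym_group k := ((t : 'S_k) * (s : 'S_k)).
Definition sym_one : sym_group k := (1 : 'S_k).
Definition sym_inv (s : sym_group k) : sym_group k := (s : 'S_k)^-1.

Lemma sym_mulA : associative sym_mul.
Proof. by move=> s t u; rewrite /sym_mul mulgA. Qed.
Lemma sym_mul1 : left_id sym_one sym_mul.
Proof. by move=> s; rewrite /sym_mul mulg1. Qed.
Lemma sym_mul1r : right_id sym_one sym_mul.
Proof. by move=> s; rewrite /sym_mul mul1g. Qed.
Lemma sym_mulV : left_inverse sym_one sym_inv sym_mul.
Proof. by move=> s; rewrite /sym_mul mulgV. Qed.
Lemma sym_mulVr : right_inverse sym_one sym_inv sym_mul.
Proof. by move=> s; rewrite /sym_mul mulVg. Qed.

HB.instance Definition _ := isGroup.Build (sym_group k)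
  sym_mulA sym_mul1 sym_mul1r sym_mulV sym_mulVr.

End sym_group.

Section PowerModDiagonal.
Local Open Scope group_scope.
Variables (T : groupType) (abT : forall x y : T, x * y = y * x) (k : nat).

Definition diag_pred : {pred {ffun 'I_k -> T}} :=
  fun t => `[< exists x : T, t = [ffun => x] >].

Lemma diag_closed : group_closed diag_pred.
Proof.
split=> [|s t /asboolP[x ->] /asboolP[y ->]]; apply/asboolP.
  by exists 1; apply/ffunP=> i; rewrite !ffunE.
by exists (x / y); apply/ffunP=> i; rewrite !ffunE.
Qed.
Lemma diag_norm s t : s \in diag_pred -> s ^ t \in diag_pred.
Proof.
move=> /asboolP[x ->]; apply/asboolP; exists x; apply/ffunP=> i.
by rewrite /conjg !ffunE abT mulgK.
Qed.
Definition diag_subgroup : normal_subgroup {ffun 'I_k -> T} :=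
  NormalSubgroup diag_closed diag_norm.

Variables (W : groupType) (w : group_action W T).

(* (pi, x) sends (t_1, ..., t_k) to the tuple with i-th entry
   x . t_(pi^-1 i). *)
Definition power_act (h : sym_group k * W) (t : {ffun 'I_k -> T}) :
    {ffun 'I_k -> T} :=
  [ffun i => w h.2 (t ((h.1 : 'S_k)^-1 i))].

Lemma power_act1 t : power_act 1 t = t.
Proof.
apply/ffunP=> i; rewrite ffunE gact1; congr (t _).
by apply: (canLR (permK _)); rewrite perm1.
Qed.
Lemma power_actM h h' t :
  power_act (h * h') t = power_act h (power_act h' t).
Proof.
apply/ffunP=> i; rewrite !ffunE gactM; congr (w _ (w _ (t _))).
by case: h h' => s p [s' p'] /=; rewrite -permM -invgM.
Qed.
Lemma power_act_morph h : {morph power_act h : s t / s * t}.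
Proof. by move=> s t; apply/ffunP=> i; rewrite !ffunE gact_morph. Qed.

Definition power_action : group_action (sym_group k * W)%type {ffun 'I_k -> T} :=
  GroupAction power_act1 power_actM power_act_morph.

Lemma power_action_diag h t : t \in diag_subgroup -> power_action h t \in diag_subgroup.
Proof.
move=> /asboolP[x ->]; apply/asboolP; exists (w h.2 x).
by apply/ffunP=> i; rewrite !ffunE.
Qed.

Definition power_mod_diag_action :
    group_action (sym_group k * W)%type (quotient_group diag_subgroup) :=
  quotient_action power_action_diag.

End PowerModDiagonal.

Section DirectSum.
Variables (I : choiceType) (V : zmodType).
Implicit Type W : I -> set V.

Definition direct_sum W : Prop :=
  (forall v, exists (s : seq I) (w : I -> V),
     [/\ uniq s, forall i, W i (w i) & v = \sum_(i <- s) w i]) /\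
  (forall (s : seq I) (w : I -> V), uniq s -> (forall i, W i (w i)) ->
     \sum_(i <- s) w i = 0 -> forall i, i \in s -> w i = 0).

End DirectSum.

Section Components.
Variables (I : choiceType) (V : zmodType) (W : I -> set V).
Hypothesis W0 : forall i, W i 0.
Hypothesis WB : forall i x y, W i x -> W i y -> W i (x - y).
Hypothesis dW : direct_sum W.

Let WN i x : W i x -> W i (- x).
Proof. by move=> Wx; rewrite -sub0r; apply: WB. Qed.
Let WD i x y : W i x -> W i y -> W i (x + y).
Proof. by move=> Wx Wy; rewrite -[y]opprK; apply/WB/WN. Qed.

Definition components v (p : I -> V) := (forall i, W i (p i)) /\
  exists s : seq I,
    [/\ uniq s, forall i, i \notin s -> p i = 0 & v = \sum_(i <- s) p i].

Lemma sum_widen (s t : seq I) (p : I -> V) : uniq s -> uniq t ->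
  {subset s <= t} -> (forall i, i \notin s -> p i = 0) ->
  \sum_(i <- t) p i = \sum_(i <- s) p i.
Proof.
move=> us ut st p0; rewrite (bigID (mem s)) /= [X in _ + X]big1 ?addr0; last first.
  by move=> i /p0.
rewrite -big_filter; apply: perm_big; apply: uniq_perm => //.
  exact: filter_uniq.
move=> i; rewrite mem_filter; apply/andP/idP => [[]//|is_]; split=> //.
exact: st.
Qed.

Lemma components_ex v : exists p, components v p.
Proof.
have [s [w [us Ww ->]]] := dW.1 v.
exists (fun i => if i \in s then w i else 0); split=> [i|].
  by case: ifP.
exists s; split=> // [i /negbTE->//|].
by rewrite big_seq [RHS]big_seq; apply: eq_bigr => i ->.
Qed.

Lemma componentsD v v' p p' : components v p -> components v' p' ->
  components (v + v') (fun i => p i + p' i).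
Proof.
move=> [Wp [s [us p0 ->]]] [Wp' [s' [us' p0' ->]]]; split=> [i|].
  exact: WD.
exists (undup (s ++ s')); split; first exact: undup_uniq.
  by move=> i; rewrite mem_undup mem_cat negb_or => /andP[/p0-> /p0'->]; rewrite addr0.
rewrite big_split /=; congr (_ + _); symmetry; apply: sum_widen => //;
  rewrite ?undup_uniq // => i; rewrite mem_undup mem_cat => ->//.
by rewrite orbT.
Qed.

Lemma componentsN v p : components v p -> components (- v) (fun i => - p i).
Proof.
move=> [Wp [s [us p0 ->]]]; split=> [i|]; first exact: WN.
exists s; split=> // [i /p0->|]; first by rewrite oppr0.
by rewrite sumrN.
Qed.

Lemma components_uniq v p q : components v p -> components v q -> p =1 q.
Proof.
move=> vp /componentsN vq i; apply/eqP; rewrite -subr_eq0; apply/eqP.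
have [Wr [s [us r0 /esym]]] := componentsD vp vq; rewrite subrr => sum0.
by have [is_|/r0//] := boolP (i \in s); apply: dW.2 sum0 _ is_.
Qed.

Definition proj v : I -> V := sval (cid (components_ex v)).

Lemma projP v : components v (proj v).
Proof. by rewrite /proj; case: cid. Qed.

Lemma proj_in v i : W i (proj v i).
Proof. exact: (projP v).1. Qed.

Lemma projE v p i : components v p -> proj v i = p i.
Proof. by move=> vp; apply: (components_uniq (projP v) vp). Qed.

Lemma projD v v' i : proj (v + v') i = proj v i + proj v' i.
Proof. by rewrite (projE _ (componentsD (projP v) (projP v'))). Qed.

Lemma proj_homog j v i : W j v -> proj v i = if i == j then v else 0.
Proof.
move=> Wv; apply: (@projE _ (fun i => if i == j then v else 0)); split=> [h|].
  by case: eqP => [->|].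
exists [:: j]; split=> // [h|]; first by rewrite inE => /negbTE->.
by rewrite big_seq1 eqxx.
Qed.

Lemma proj_id j v : W j v -> proj v j = v.
Proof. by move/proj_homog->; rewrite eqxx. Qed.

Lemma proj0 i : proj 0 i = 0.
Proof. by rewrite (proj_homog _ (W0 i)) if_same. Qed.

Lemma proj_sum (J : Type) (r : seq J) (f : J -> V) i :
  proj (\sum_(j <- r) f j) i = \sum_(j <- r) proj (f j) i.
Proof.
by rewrite (big_morph (fun v => proj v i) (fun x y => projD x y i) (proj0 i)).
Qed.

Lemma proj_sum_eq v (s : seq I) : uniq s ->
  (forall i, i \notin s -> proj v i = 0) -> \sum_(i <- s) proj v i = v.
Proof.
move=> us s0; have [_ [t [ut t0 vE]]] := projP v.
have uu := undup_uniq (s ++ t).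
rewrite [RHS]vE -(@sum_widen s (undup (s ++ t))) //; last first.
  by move=> i; rewrite mem_undup mem_cat => ->.
by apply: sum_widen => // i; rewrite mem_undup mem_cat => ->; rewrite orbT.
Qed.

Lemma proj_eq0 v : (forall i, proj v i = 0) -> v = 0.
Proof. by move=> v0; rewrite -(@proj_sum_eq v [::]) ?big_nil. Qed.

End Components.

Lemma proj_shift (I J : choiceType) (U V : zmodType)
    (X : I -> set U) (Y : J -> set V)
    (dX : direct_sum X) (dY : direct_sum Y)
    (X0 : forall i, X i 0) (Y0 : forall i, Y i 0) (YB : forall i x y, Y i x -> Y i y -> Y i (x - y))
    (f : {additive U -> V}) (a : I -> J) (b : J -> I) :
    cancel a b -> cancel b a ->
    (forall i x, X i x -> Y (a i) (f x)) ->
  forall u i, proj Y0 dY (f u) (a i) = f (proj X0 dX u i).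
Proof.
move=> ab ba fXY u i; rewrite -{2}(ab i).
apply: (projE Y0 YB dY (p := fun j => f (proj X0 dX u (b j)))).
have [Xp [s [us p0 uE]]] := projP X0 dX u; split=> [j|].
  by rewrite -[X in Y X](ba j); apply: fXY.
exists (map a s); split; first by rewrite map_inj_uniq //; apply: can_inj ab.
  move=> j js; rewrite p0 ?raddf0 //; apply: contra js => /(map_f a).
  by rewrite ba.
by rewrite {1}uE raddf_sum big_map; apply: eq_bigr => l _; rewrite ab.
Qed.

Section Grading.
Variables (G : groupType) (F : fieldType).

Record grading (R : algType F) := Grading {
  hcomp :> G -> set R;
  hcomp0 : forall g, hcomp g 0;
  hcompZD : forall g (c : F) x y,
    hcomp g x -> hcomp g y -> hcomp g (c *: x + y);
  hcomp_direct : direct_sum hcomp;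
  hcompM : forall g h x y,
    hcomp g x -> hcomp h y -> hcomp (g * h)%g (x * y)
}.

Definition support (R : algType F) (Gamma : grading R) : {pred G} :=
  fun g => `[< exists2 x, Gamma g x & x != 0 >].

Definition graded_division (D : algType F) (Gamma : grading D) : Prop :=
  forall g d, Gamma g d -> d != 0 -> exists d', d * d' = 1 /\ d' * d = 1.

Section GradingTheory.
Variables (R : algType F) (Gamma : grading R).

Lemma hcompB g x y : Gamma g x -> Gamma g y -> Gamma g (x - y).
Proof. by move=> gx gy; rewrite addrC -scaleN1r; apply: hcompZD. Qed.

Let p := proj (hcomp0 Gamma) (hcomp_direct Gamma).

Lemma proj_mull g h x y : Gamma g x -> p (x * y) h = x * p y (g^-1 * h)%g.
Proof.
move=> gx; rewrite -{1}(mulVKg g h).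
have -> : p (x * y) = p ((x \*o (idfun : {additive R -> R})) y) by [].
apply: (@proj_shift _ _ _ _ _ _ _ _ (hcomp0 Gamma) (hcomp0 Gamma) hcompB
  _ _ (fun l => g^-1 * l)%g) => [l|l|l z /= lz]; rewrite ?mulKg ?mulVKg //.
exact: hcompM.
Qed.

Lemma hcomp_1 : Gamma 1%g 1.
Proof.
have e x : x * p 1 1%g = x.
  have H g y : Gamma g y -> y * p 1 1%g = y.
    move=> gy; have := proj_mull g 1 gy.
    by rewrite mulVg mulr1 => <-; apply: (proj_id (hcomp0 _) hcompB).
  have [_ [s [_ _ ->]]] := projP (hcomp0 Gamma) (hcomp_direct Gamma) x.
  rewrite mulr_suml; apply: eq_bigr => i _; apply: H; exact: proj_in.
by rewrite -[1 in X in _ X]e mul1r; apply: proj_in.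
Qed.

Lemma hcomp_neq g h x : Gamma g x -> Gamma h x -> x != 0 -> g = h.
Proof.
move=> gx hx; rewrite -{1}(proj_id (hcomp0 _) hcompB (hcomp_direct _) gx).
rewrite (proj_homog (hcomp0 _) hcompB (hcomp_direct _) _ hx).
by case: (g =P h) => //; rewrite eqxx.
Qed.

End GradingTheory.

Section SupportGroup.
Variables (D : algType F) (Gamma0 : grading D) (hD : graded_division Gamma0).

Lemma support_closed : group_closed (support Gamma0).
Proof.
split=> [|g h /asboolP[x gx x0] /asboolP[y hy y0]]; apply/asboolP.
  by exists 1; [exact: hcomp_1 | exact: oner_neq0].
have [x' [_ x'x]] := hD gx x0; have [y' [yy' _]] := hD hy y0.
pose z := proj (hcomp0 _) (hcomp_direct Gamma0) y' h^-1%g.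
have yz : y * z = 1.
  have := proj_mull 1%g y' hy; rewrite yy' mulg1 => <-.
  by apply: proj_id; [exact: hcompB|exact: hcomp_1].
exists (x * z); first by apply: hcompM => //; apply: proj_in.
apply/eqP => xz0; have : x' * (x * z) = 0 by rewrite xz0 mulr0.
rewrite mulrA x'x mul1r => z0; move: yz; rewrite z0 mulr0 => /esym/eqP.
by rewrite oner_eq0.
Qed.

Definition support_group (_ : graded_division Gamma0) : Type :=
  {t : G | t \in support Gamma0}.
HB.instance Definition _ := SubChoice.on (support_group hD).
HB.instance Definition _ :=
  SubChoice_isSubGroup.Build G (support Gamma0) (support_group hD)
    support_closed.

End SupportGroup.
End Grading.

Arguments support_group {G F D Gamma0} _.

Section AlgebraAutomorphisms.
Variables (F : fieldType) (R : algType F).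

Record alg_aut := AlgAut {
  aut_fun :> {lrmorphism R -> R};
  aut_bij : bijective aut_fun
}.

HB.instance Definition _ := gen_eqMixin alg_aut.
HB.instance Definition _ := gen_choiceMixin alg_aut.

Lemma alg_autP (f g : alg_aut) : f =1 g -> f = g.
Proof.
case: f g => [[f cf] bf] [[g cg] bg] /= /funext fg; subst g.
have ecc : cf = cg.
  case: cf {bf} => [[a] [b] [c]]; case: cg {bg} => [[a'] [b'] [c']].
  by rewrite (Prop_irrelevance a a') (Prop_irrelevance b b')
             (Prop_irrelevance c c').
by subst cg; rewrite (Prop_irrelevance bf bg).
Qed.

Definition aut_one : alg_aut :=
  @AlgAut (@idfun R) (Bijective (g := id) (frefl _) (frefl _)).
Definition aut_mul (f g : alg_aut) : alg_aut :=
  @AlgAut (f \o g) (bij_comp (aut_bij f) (aut_bij g)).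

Lemma aut_inv_ex (f : alg_aut) :
  exists g : alg_aut, cancel f g /\ cancel g f.
Proof.
case: f => f bf /=; have [g fg gf] := bf.
have gm : zmod_morphism g by exact: can2_zmod_morphism fg gf.
have gM : monoid_morphism g by exact: can2_monoid_morphism fg gf.
have gZ : scalable g by exact: can2_scalable fg gf.
pose B := GRing.isZmodMorphism.Build _ _ g gm.
pose C := GRing.isMonoidMorphism.Build _ _ g gM.
pose E := GRing.isScalable.Build _ _ _ _ g gZ.
pose g' : {lrmorphism R -> R} := HB.pack g B C E.
by exists (@AlgAut g' (Bijective gf fg)).
Qed.

Definition aut_inv f := sval (cid (aut_inv_ex f)).

Lemma aut_invK (f : alg_aut) : cancel f (aut_inv f).
Proof. by rewrite /aut_inv; case: cid => g []. Qed.
Lemma aut_invKV (f : alg_aut) : cancel (aut_inv f) f.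
Proof. by rewrite /aut_inv; case: cid => g []. Qed.

Lemma aut_mulA : associative aut_mul.
Proof. by move=> f g h; apply: alg_autP. Qed.
Lemma aut_mul1 : left_id aut_one aut_mul.
Proof. by move=> f; apply: alg_autP. Qed.
Lemma aut_mul1r : right_id aut_one aut_mul.
Proof. by move=> f; apply: alg_autP. Qed.
Lemma aut_mulV : left_inverse aut_one aut_inv aut_mul.
Proof. by move=> f; apply: alg_autP => x; apply: aut_invK. Qed.
Lemma aut_mulVr : right_inverse aut_one aut_inv aut_mul.
Proof. by move=> f; apply: alg_autP => x; apply: aut_invKV. Qed.

HB.instance Definition _ := isGroup.Build alg_aut
  aut_mulA aut_mul1 aut_mul1r aut_mulV aut_mulVr.

End AlgebraAutomorphisms.

Section WeylGroup.
Variables (G : groupType) (F : fieldType) (R : algType F).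
Variable Gamma : grading G R.

(* Zero components are included on both sides: an automorphism maps 0 to
   itself and no nonzero component to 0.  Closure under inverses is
   self_equivalence_closed. *)
Definition self_equivalence : {pred alg_aut R} :=
  fun f => `[< forall g, exists h, f @` Gamma g = Gamma h >].

Lemma aut_image_inv (f : alg_aut R) (A B : set R) :
  f @` A = B -> (f^-1)%g @` B = A.
Proof.
move=> <-; rewrite image_comp; apply/seteqP; split=> [_ [x Ax <-]|x Ax].
  by rewrite /= (aut_invK f x : (f^-1)%g (f x) = x).
by exists x => //=; apply: aut_invK.
Qed.

Lemma aut_image_mul (f g : alg_aut R) (A : set R) :
  (f * g)%g @` A = f @` (g @` A).
Proof. by rewrite image_comp. Qed.

Lemma aut_image1 (A : set R) : (1%g : alg_aut R) @` A = A.
Proof. exact: image_id. Qed.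

Lemma self_equivalence_closed : group_closed self_equivalence.
Proof.
have eqM f g : f \in self_equivalence -> g \in self_equivalence ->
    (f * g)%g \in self_equivalence.
  move=> /asboolP fP /asboolP gP; apply/asboolP => i.
  have [j gj] := gP i; have [l fl] := fP j; exists l.
  by rewrite aut_image_mul gj.
have eqV f : f \in self_equivalence -> (f^-1)%g \in self_equivalence.
  move=> /asboolP fP; apply/asboolP => h.
  have [[x hx x0]|nx] := pselect (exists2 x, Gamma h x & x != 0); last first.
    exists h; have -> : Gamma h = [set 0].
      apply/seteqP; split=> [x hx|_ ->]; last exact: hcomp0.
      by apply/eqP/negP => /negP x0; apply: nx; exists x.
    by rewrite image_set1 raddf0.
  suff [g fg] : exists g, f @` Gamma g = Gamma h.
    by exists g; apply: aut_image_inv.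
  apply: contrapT => nfg.
  have [w0 wB] := (hcomp0 Gamma, @hcompB _ _ _ Gamma).
  have dG := hcomp_direct Gamma.
  have [_ [s [_ _ yE]]] := projP w0 dG ((f^-1)%g x).
  suff : proj w0 dG x h = 0.
    by rewrite proj_id // => /eqP; apply/negP.
  have -> : x = \sum_(i <- s) f (proj w0 dG ((f^-1)%g x) i).
    by rewrite -raddf_sum -yE; symmetry; apply: aut_invKV.
  rewrite proj_sum //; apply: big1 => i _.
  have [j fj] := fP i; have fij : Gamma j (f (proj w0 dG ((f^-1)%g x) i)).
    by rewrite -fj; exists (proj w0 dG ((f^-1)%g x) i) => //; apply: proj_in.
  rewrite (proj_homog _ wB _ _ fij); case: (h =P j) => // hj.
  by case: nfg; exists i; rewrite fj hj.
split=> [|f g fP gP]; last by apply: eqM => //; apply: eqV.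
by apply/asboolP=> g; exists g; apply: aut_image1.
Qed.

Definition aut_grading : Type := {f : alg_aut R | f \in self_equivalence}.
HB.instance Definition _ := SubChoice.on aut_grading.
HB.instance Definition _ := SubChoice_isSubGroup.Build
  (alg_aut R) self_equivalence aut_grading self_equivalence_closed.

Definition stab_pred : {pred aut_grading} :=
  fun f => `[< forall g, val f @` Gamma g = Gamma g >].

Lemma stab_closed : group_closed stab_pred.
Proof.
split=> [|f g /asboolP fP /asboolP gP]; apply/asboolP => i.
  exact: aut_image1.
have -> : val (f / g)%g = (val f * (val g)^-1)%g by [].
by rewrite aut_image_mul (aut_image_inv (gP i)).
Qed.

Lemma stab_norm f g : f \in stab_pred -> (f ^ g)%g \in stab_pred.
Proof.
move=> /asboolP fP; apply/asboolP => i.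
have -> : val (f ^ g)%g = ((val g)^-1 * (val f * val g))%g by [].
have /asboolP/(_ i)[j gj] := valP g.
by rewrite !aut_image_mul gj fP (aut_image_inv gj).
Qed.

Definition stab_grading : normal_subgroup aut_grading :=
  NormalSubgroup stab_closed stab_norm.

Definition weyl_group := quotient_group stab_grading.
HB.instance Definition _ := Group.on weyl_group.

End WeylGroup.

Section WeylAction.
Variables (G : groupType) (F : fieldType) (D : algType F).
Variables (Gamma0 : grading G D) (hD : graded_division Gamma0).

Local Notation T := (support_group hD).
Local Notation W := (weyl_group Gamma0).
Local Notation pi := (\pi_(quotient_group (stab_grading Gamma0))%qT).

Lemma image_degree_ex (f : aut_grading Gamma0) (t : T) :
  exists t' : T, val f @` Gamma0 (val t) = Gamma0 (val t').
Proof.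
have /asboolP/(_ (val t))[h fh] := valP f.
have /asboolP[x tx x0] := valP t.
have hT : h \in support Gamma0.
  apply/asboolP; exists (val f x); first by rewrite -fh; exists x.
  by rewrite -(raddf0 (val f)) (bij_eq (aut_bij (val f))).
by exists (Sub h hT); rewrite SubK.
Qed.

Lemma image_degree_uniq (A : set D) (t t' : T) :
  A = Gamma0 (val t) -> A = Gamma0 (val t') -> t = t'.
Proof.
move=> At At'; apply: val_inj; have /asboolP[x tx x0] := valP t.
by apply: hcomp_neq (tx) _ x0; rewrite -At' At.
Qed.

Definition image_degree (f : aut_grading Gamma0) (t : T) : T :=
  sval (cid (image_degree_ex f t)).

Lemma image_degreeP (f : aut_grading Gamma0) (t : T) :
  val f @` Gamma0 (val t) = Gamma0 (val (image_degree f t)).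
Proof. by rewrite /image_degree; case: cid. Qed.

Lemma image_degreeE (f : aut_grading Gamma0) (t t' : T) :
  val f @` Gamma0 (val t) = Gamma0 (val t') -> image_degree f t = t'.
Proof. exact/image_degree_uniq/image_degreeP. Qed.

Definition weyl_act (w : W) (t : T) : T := image_degree (repr w) t.

Lemma weyl_act_pi (f : aut_grading Gamma0) t :
  weyl_act (pi f) t = image_degree f t.
Proof.
symmetry; apply: image_degreeE; rewrite -image_degreeP.
have /asboolP rf := pi_repr (stab_grading Gamma0) f.
set r := repr _ in rf *.
have -> : val f = (val r * (val r^-1 * val f))%g by rewrite mulVKg.
by rewrite aut_image_mul (rf (val t)).
Qed.

Lemma weyl_act1 t : weyl_act 1%g t = t.
Proof. by rewrite weyl_act_pi; apply: image_degreeE; apply: aut_image1. Qed.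

Lemma weyl_actM w w' t : weyl_act (w * w')%g t = weyl_act w (weyl_act w' t).
Proof.
elim/quotW: w => f; elim/quotW: w' => g.
have -> : (pi f * pi g)%g = pi (f * g)%g by exact: pi_mul.
rewrite !weyl_act_pi; apply: image_degreeE.
by rewrite -image_degreeP -image_degreeP -aut_image_mul.
Qed.

Lemma weyl_act_morph w : {morph weyl_act w : s t / (s * t)%g}.
Proof.
move=> s t; rewrite /weyl_act; set f := repr w.
apply: val_inj; have /asboolP[x sx x0] := valP s.
have /asboolP[y ty y0] := valP t.
have xy0 : x * y != 0.
  apply/eqP => xy; have [x' [_ x'x]] := hD sx x0.
  by move: y0; rewrite -[y]mul1r -x'x -mulrA xy mulr0 eqxx.
have img u z : Gamma0 (val u) z -> Gamma0 (val (image_degree f u)) (val f z).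
  by move=> uz; rewrite -image_degreeP; exists z.
apply: (@hcomp_neq _ _ _ Gamma0 _ _ (val f (x * y))).
- by apply: img; apply: hcompM.
- by rewrite rmorphM; apply: hcompM; apply: img.
- by rewrite -(raddf0 (val f)) (bij_eq (aut_bij (val f))).
Qed.

Definition weyl_action : group_action W T :=
  GroupAction weyl_act1 weyl_actM weyl_act_morph.

Lemma support_group_comm : (forall g h : G, (g * h)%g = (h * g)%g) ->
  forall s t : T, (s * t)%g = (t * s)%g.
Proof. by move=> hG s t; apply: val_inj; apply: hG. Qed.

End WeylAction.

(* D^c is the opposite algebra of D: a left D^c-module is a right D-module. *)
Definition ract (D : pzRingType) (V : lmodType D^c) (v : V) (d : D) : V :=
  (d : D^c) *: v.
Arguments ract : simpl never.

Fact ract_is_additive (D : pzRingType) (V : lmodType D^c) (v : V) :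
  zmod_morphism (@ract D V v).
Proof. by move=> x y; rewrite /ract scalerBl. Qed.
HB.instance Definition _ (D : pzRingType) (V : lmodType D^c) (v : V) :=
  GRing.isZmodMorphism.Build D V (@ract D V v) (ract_is_additive v).

Section GradedModule.
Variables (G : groupType) (F : fieldType) (D : algType F).
Variables (Gamma0 : grading G D) (V : lmodType D^c).

(* F acts on V through the scalars c%:A of D *)
Record module_grading := ModuleGrading {
  mcomp :> G -> set V;
  mcomp0 : forall g, mcomp g 0;
  mcompZD : forall g (c : F) v w,
    mcomp g v -> mcomp g w -> mcomp g (ract v c%:A + w);
  mcomp_direct : direct_sum mcomp;
  mcompM : forall g h v d,
    mcomp g v -> Gamma0 h d -> mcomp (g * h)%g (ract v d)
}.

Variable VG : module_grading.

(* the graded submodule U has a homogeneous D-basis of n elements *)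
Definition graded_dim (U : set V) (n : nat) : Prop :=
  exists b : 'I_n -> V,
    [/\ forall i, U (b i), forall i, exists g, VG g (b i) &
        forall v, U v ->
          exists! c : {ffun 'I_n -> D}, v = \sum_i ract (b i) (c i)].

Definition coset_eq (g h : G) : Prop := (g^-1 * h)%g \in support Gamma0.

(* the sum of the VG h over h in gT *)
Definition isotypic (g : G) : set V :=
  [set v | exists (s : seq G) (w : G -> V),
     [/\ forall h, h \in s -> coset_eq g h, forall h, VG h (w h)
       & v = \sum_(h <- s) w h]].

(* g_1 T, ..., g_s T are the distinct supports of the isotypic components *)
Definition isotypic_supports (s : nat) (g : 'I_s -> G) : Prop :=
  (forall i j, coset_eq (g i) (g j) -> i = j) /\
  (forall h, (exists2 v, isotypic h v & v != 0) <->
             exists i, coset_eq (g i) h).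

Definition fine_condition : Prop :=
  exists (s : nat) (g : 'I_s -> G),
    [/\ isotypic_supports g,
        forall i, graded_dim (isotypic (g i)) 1 &
        forall i j h l, i != j -> (i, j) != (h, l) ->
          ~ coset_eq (g i * (g j)^-1)%g (g h * (g l)^-1)%g].

End GradedModule.

Section Endomorphisms.
Variables (F : fieldType) (D : algType F) (V : lmodType D^c).
Hypothesis V0 : exists v : V, v != 0.

(* nontriviality of V is what makes the ring of endomorphisms nonzero *)
Definition right_end (_ : exists v : V, v != 0) : Type := {linear V -> V}.
Local Notation endD := (right_end V0).
Definition right_end_fun (r : endD) : {linear V -> V} := r.
Coercion right_end_fun : right_end >-> GRing.Linear.type.

HB.instance Definition _ := gen_eqMixin endD.
HB.instance Definition _ := gen_choiceMixin endD.

Lemma right_endP (f g : endD) : (f : V -> V) =1 g -> f = g.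
Proof.
case: f g => [f cf] [g cg] /= /funext fg; subst g.
have -> // : cf = cg.
case: cf => [[a] [b]]; case: cg => [[a'] [b']].
by rewrite (Prop_irrelevance a a') (Prop_irrelevance b b').
Qed.

Let scale_fun_sub (c : F) (f : endD) : V -> V := fun v => ract (f v) c%:A.
Let scale_fun_linear c f : linear (scale_fun_sub c f).
Proof.
move=> a u v; rewrite /scale_fun_sub /ract linearP scalerDr !scalerA.
congr (_ *: _ + _).
have -> : (c%:A : D^c) * a = (a : D) * c%:A by [].
have -> : a * (c%:A : D^c) = (c%:A : D) * (a : D) by [].
by rewrite mulr_algl mulr_algr.
Qed.
HB.instance Definition _ c f := GRing.isLinear.Build D^c V V _
  (scale_fun_sub c f) (scale_fun_linear c f).

Definition end_zero : endD := \0 : {linear V -> V}.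
Definition end_add (f g : endD) : endD := f \+ g : {linear V -> V}.
Definition end_opp (f : endD) : endD := \- f : {linear V -> V}.
Definition end_one : endD := idfun : {linear V -> V}.
Definition end_mul (f g : endD) : endD := f \o g : {linear V -> V}.
Definition end_scale (c : F) (f : endD) : endD :=
  scale_fun_sub c f : {linear V -> V}.

Fact end_addA : associative end_add.
Proof. by move=> f g h; apply: right_endP => v; apply: addrA. Qed.
Fact end_addC : commutative end_add.
Proof. by move=> f g; apply: right_endP => v; apply: addrC. Qed.
Fact end_add0 : left_id end_zero end_add.
Proof. by move=> f; apply: right_endP => v; apply: add0r. Qed.
Fact end_addN : left_inverse end_zero end_opp end_add.
Proof. by move=> f; apply: right_endP => v; apply: addNr. Qed.
HB.instance Definition _ := GRing.isZmodule.Build endD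
  end_addA end_addC end_add0 end_addN.

Fact end_mulA : associative end_mul.
Proof. by move=> f g h; apply: right_endP. Qed.
Fact end_mul1 : left_id end_one end_mul.
Proof. by move=> f; apply: right_endP. Qed.
Fact end_mul1r : right_id end_one end_mul.
Proof. by move=> f; apply: right_endP. Qed.
Fact end_mulDl : left_distributive end_mul end_add.
Proof. by move=> f g h; apply: right_endP. Qed.
Fact end_mulDr : right_distributive end_mul end_add.
Proof. by move=> f g h; apply: right_endP => v; apply: raddfD. Qed.
Fact end_one_neq0 : end_one != end_zero.
Proof.
have [v v0] := V0; apply/eqP => e; case/eqP: v0.
by have /(congr1 (fun f : endD => f v)) := e.
Qed.
HB.instance Definition _ := GRing.Zmodule_isNzRing.Build endD
  end_mulA end_mul1 end_mul1r end_mulDl end_mulDr end_one_neq0.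

Fact end_scaleA a b f : end_scale a (end_scale b f) = end_scale (a * b) f.
Proof.
apply: right_endP => v; rewrite /= /scale_fun_sub /ract scalerA; congr (_ *: _).
have -> : (a%:A : D^c) * (b%:A : D^c) = (b%:A : D) * a%:A by [].
by rewrite mulr_algl scalerA mulrC.
Qed.
Fact end_scale1 : left_id 1 end_scale.
Proof.
by move=> f; apply: right_endP => v; rewrite /= /scale_fun_sub /ract !scale1r.
Qed.
Fact end_scaleDr : right_distributive end_scale +%R.
Proof.
by move=> c f g; apply: right_endP => v; rewrite /= /scale_fun_sub /ract scalerDr.
Qed.
Fact end_scaleDl f : {morph end_scale^~ f : a b / a + b}.
Proof.
move=> a b; apply: right_endP => v.
by rewrite /= /scale_fun_sub /ract scalerDl [LHS]scalerDl.
Qed.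
HB.instance Definition _ := GRing.Zmodule_isLmodule.Build F endD
  end_scaleA end_scale1 end_scaleDr end_scaleDl.

Fact end_scaleAl (c : F) (f g : endD) : c *: (f * g) = (c *: f) * g.
Proof. by apply: right_endP. Qed.
HB.instance Definition _ := GRing.Lmodule_isLalgebra.Build F endD end_scaleAl.
Fact end_scaleAr (c : F) (f g : endD) : c *: (f * g) = f * (c *: g).
Proof. by apply: right_endP => v; symmetry; apply: linearZZ. Qed.
HB.instance Definition _ := GRing.Lalgebra_isAlgebra.Build F endD end_scaleAr.

End Endomorphisms.

Section EndGrading.
Variables (G : groupType) (F : fieldType) (D : algType F).
Variables (Gamma0 : grading G D) (V : lmodType D^c).
Variable VG : module_grading Gamma0 V.
Hypothesis V0 : exists v : V, v != 0.
Variable k : nat.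
Hypothesis dimV : graded_dim VG setT k.

Local Notation R := (right_end V0).

Definition end_comp (g : G) : set R :=
  [set r | forall h v, VG h v -> VG (g * h)%g (r v)].

Let mcompD g v w : VG g v -> VG g w -> VG g (v + w).
Proof.
by move=> gv gw; have := mcompZD 1 gv gw; rewrite /ract !scale1r.
Qed.
Let mcompN g v : VG g v -> VG g (- v).
Proof.
move=> gv; have := mcompZD (-1) gv (mcomp0 VG g).
by rewrite /ract scaleN1r (scaleN1r v) addr0.
Qed.
Let mcompB g v w : VG g v -> VG g w -> VG g (v - w).
Proof. by move=> gv /mcompN; apply: mcompD. Qed.
Let mcomp_sum g (I : Type) (s : seq I) (P : pred I) (w : I -> V) :
  (forall i, P i -> VG g (w i)) -> VG g (\sum_(i <- s | P i) w i).
Proof. by move=> H; elim/big_ind: _ => // [|x y]; [exact: mcomp0|exact: mcompD]. Qed.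

Local Notation pV := (proj (mcomp0 VG) (mcomp_direct VG)).
Local Notation pD := (proj (hcomp0 Gamma0) (hcomp_direct Gamma0)).

Let proj_ract h v a u : VG h v -> pV (ract v a) u = ract v (pD a (h^-1 * u)%g).
Proof.
move=> hv; rewrite -{1}(mulVKg h u).
apply: (@proj_shift _ _ _ _ _ _ _ _ (hcomp0 Gamma0) (mcomp0 VG) mcompB
  (@ract D V v) (fun l => h * l)%g (fun l => h^-1 * l)%g)
  => [l|l|l z lz]; rewrite ?mulKg ?mulVKg //.
exact: mcompM.
Qed.

Lemma end_comp0 g : end_comp g 0.
Proof. by move=> h v _; apply: mcomp0. Qed.

Lemma end_compZD g (c : F) (x y : R) :
  end_comp g x -> end_comp g y -> end_comp g (c *: x + y).
Proof. by move=> gx gy h v hv; apply: mcompZD; [apply: gx|apply: gy]. Qed.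

Lemma end_compM g h (x y : R) :
  end_comp g x -> end_comp h y -> end_comp (g * h)%g (x * y).
Proof. by move=> gx hy l v lv; rewrite -mulgA; apply/gx/hy. Qed.

Lemma right_end_sum (I : Type) (s : seq I) (w : I -> R) (v : V) :
  (\sum_(i <- s) w i : R) v = \sum_(i <- s) w i v.
Proof. by elim/big_rec2: _ => // i x r _ <-. Qed.

Lemma end_comp_direct : direct_sum end_comp.
Proof.
split=> [r|s w us ws sum0 g gs]; last first.
  apply: right_endP => v.
  have [_ [t [_ _ ->]]] := projP (mcomp0 VG) (mcomp_direct VG) v.
  rewrite raddf_sum big1 // => u _; set x := proj _ _ _ u.
  have ux : VG u x by apply: proj_in.
  have := (mcomp_direct VG).2 [seq (l * u)%g | l <- s]
    (fun l => w (l * u^-1)%g x).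
  move=> /(_ _ _ _ (g * u)%g); rewrite mulgK; apply.
  - by rewrite map_inj_uniq //; apply: mulIg.
  - by move=> i; rewrite -[X in VG X](mulgVK u i); apply: ws.
  - rewrite big_map; under eq_bigr do rewrite mulgK.
    by rewrite -right_end_sum sum0.
  - by apply/mapP; exists g.
have [b [_ bh bB]] := dimV.
have [h hb] := choice bh.
have /choice[c cP] : forall v, exists c : {ffun 'I_k -> D},
    v = \sum_i ract (b i) (c i) /\
    forall c' : {ffun 'I_k -> D}, v = \sum_i ract (b i) (c' i) -> c = c'.
  by move=> v; have [|c [? ?]] := bB v; [|exists c].
have cE v : v = \sum_i ract (b i) (c v i) by case: (cP v).
have cU v c' : v = \sum_i ract (b i) (c' i) -> c v =1 c'.
  move=> e i; have [_ /(_ [ffun i => c' i])->] := cP v; first by rewrite ffunE.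
  by rewrite {1}e; apply: eq_bigr => j _; rewrite ffunE.
have cin u v i : VG u v -> Gamma0 ((h i)^-1 * u)%g (c v i).
  move=> uv; rewrite (@cU v (fun i => pD (c v i) ((h i)^-1 * u)%g)).
    exact: proj_in.
  rewrite -{1}(proj_id (mcomp0 VG) mcompB (mcomp_direct VG) uv) {1}[v in LHS]cE.
  rewrite proj_sum //; apply: eq_bigr => j _; exact: proj_ract.
pose f g v := \sum_i ract (pV (r (b i)) (g * h i)%g) (c v i).
have fL g : linear (f g).
  move=> a v w; rewrite /f scaler_sumr -big_split; apply: eq_bigr => i _ /=.
  have -> : c (a *: v + w) i = c v i * (a : D) + c w i.
    apply: (@cU _ (fun i => c v i * (a : D) + c w i)).
    rewrite {1}[v]cE {1}[w]cE scaler_sumr -big_split; apply: eq_bigr => j _ /=.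
    by rewrite /ract scalerDl scalerA.
  by rewrite /ract scalerDl scalerA.
pose Bf g := GRing.isLinear.Build D^c V V _ (f g) (fL g).
pose w g : R := (HB.pack (f g) (Bf g) : {linear V -> V}).
have wE g v : w g v = f g v by [].
pose S := undup (flatten [seq [seq (u * (h i)^-1)%g |
  u <- sval (cid (projP (mcomp0 VG) (mcomp_direct VG) (r (b i))).2)] | i : 'I_k]).
exists S, w; split; first exact: undup_uniq.
  move=> g u v uv; rewrite wE; apply: mcomp_sum => i _.
  have -> : (g * u = (g * h i) * ((h i)^-1 * u))%g by rewrite -mulgA mulVKg.
  by apply: mcompM; [apply: proj_in|apply: cin].
apply: right_endP => v; rewrite right_end_sum.
under eq_bigr do rewrite wE.
rewrite exchange_big {1}[v]cE raddf_sum; apply: eq_bigr => i _ /=.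
have -> : r (ract (b i) (c v i)) = ract (r (b i)) (c v i) by apply: linearZZ.
rewrite /ract -scaler_sumr; congr (_ *: _); symmetry.
transitivity (\sum_(u <- [seq (g * h i)%g | g <- S]) pV (r (b i)) u).
  by rewrite big_map.
apply: proj_sum_eq => [|u uS].
  by rewrite map_inj_uniq ?undup_uniq //; apply: mulIg.
have := svalP (cid (projP (mcomp0 VG) (mcomp_direct VG) (r (b i))).2).
set t := sval _ => -[_ t0 _]; apply: t0; apply: contra uS => ut.
rewrite -[u](mulgVK (h i)); apply: map_f; rewrite mem_undup.
apply/flattenP; exists [seq (u * (h i)^-1)%g | u <- t]; last exact: map_f.
by apply/mapP; exists i; rewrite ?mem_enum.
Qed.

Definition end_grading : grading G R :=
  Grading end_comp0 end_compZD end_comp_direct end_compM.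

End EndGrading.

(* Main.v *)
(* A homogeneous basis b_1, ..., b_k of V, with b_i of degree h_i, identifies R
   with the k x k matrices over D in such a way that E_ij D_t is homogeneous of
   degree h_i t h_j^-1.  By the fine condition the homogeneous components are
   the spaces E_ij D_t for i != j and the sums of the E_ii D_t over all i.  A
   self-equivalence psi fixes the component of degree 1, so it permutes its
   primitive idempotents E_ii by some s in Sym(k).  Reading off the matrix entry
   of psi(E_ii d) for one index i gives psi_0 in Aut(Gamma_0), and the degrees
   tau_(s j) of the entries of the psi(E_ji) give
   psi(E_ij D_t) = E_(s i)(s j) D_t' with t' = tau_(s i) psi_0(t) tau_(s j)^-1.
   The tuple tau is determined up to the diagonal, and the triples
   (tau, s, psi_0) compose as in the semidirect product.  Every triple arises,
   from conjugation by the semilinear map b_i d |-> b_(s i) u_(s i) psi_0(d)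
   with u_j in D_(tau_j). *)
From HB Require Import structures.
Require Import Defs.
From mathcomp Require Import all_boot fingroup perm all_algebra generic_quotient.
From mathcomp Require Import boolp classical_sets.

Set Implicit Arguments.
Unset Strict Implicit.
Unset Printing Implicit Defensive.

Import GRing.Theory.
Local Open Scope classical_set_scope.
Local Open Scope ring_scope.

(** * Isomorphisms out of quotient groups *)

(** First isomorphism theorem for a homomorphism given as a relation [P]. Totality, multiplicativity
    and the kernel condition already force [P] to be single-valued, so no image has to be chosen
    when the lemma is applied. *)
Lemma quotient_isomorphic (A H : groupType) (N : normal_subgroup A)
    (P : A -> H -> Prop) :
    (forall a, exists h, P a h) -> (forall h, exists a, P a h) ->
    (forall a a' h h', P a h -> P a' h' -> P (a * a')%g (h * h')%g) ->
    (forall a h, P a h -> (a \in N <-> h = 1%g)) ->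
  isomorphic (quotient_group N) H.
Proof.
pose pi := \pi_(quotient_group N)%qT.
move=> Ptot Psurj PM PN.
have N1 : (1%g : A) \in N by exact: (nsub_closed N).1.
(* Any value [z] at [a^-1] is inverse to both [h] and [h'], because the product of [a] and [a^-1]
   lies in [N]. *)
have Pinj a h h' : P a h -> P a h' -> h = h'.
  move=> ah ah'; have [z za] := Ptot (a^-1)%g.
  have /PN := PM _ _ _ _ ah za; rewrite mulgV => /iffLR/(_ N1) hz.
  have /PN := PM _ _ _ _ ah' za; rewrite mulgV => /iffLR/(_ N1) h'z.
  by apply: (mulIg z); rewrite hz h'z.
have PV a h : P a h -> P (a^-1)%g (h^-1)%g.
  move=> ah; have [z za] := Ptot (a^-1)%g.
  have /PN := PM _ _ _ _ ah za; rewrite mulgV => /iffLR/(_ N1) hz.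
  by rewrite -(mulKg h z) hz mulg1 in za.
have PNr a n h : P a h -> n \in N -> P (a * n)%g h.
  move=> ah Nn; have [z nz] := Ptot n.
  by have := PM _ _ _ _ ah nz; rewrite ((PN _ _ nz).1 Nn) mulg1.
(* A value at the representative is a value at every element of its coset, by [PNr]. *)
pose f (q : quotient_group N) := sval (cid (Ptot (repr q))).
have fP a : P a (f (pi a)).
  rewrite /f; case: cid => h /= ah.
  by rewrite -(mulVKg (repr (pi a)) a); apply: PNr (pi_repr N a).
have fM : {morph f : p q / (p * q)%g}.
  elim/quotW=> a; elim/quotW=> b; apply: (Pinj (a * b)%g).
    by have -> : (pi a * pi b)%g = pi (a * b)%g
      by exact: Defs.pi_mul.
  exact: PM.
pose fB := isMultiplicative.Build _ _ f fM.
exists (HB.pack f fB : {multiplicative quotient_group N -> H}).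
exists (fun h => pi (sval (cid (Psurj h)))).
  elim/quotW=> a /=; case: cid => b /= bf; apply/coset_eqP.
  by apply: (PN _ _ (PM _ _ _ _ (PV _ _ bf) (fP a))).2; rewrite mulVg.
by move=> h /=; case: cid => b /= bh; apply: Pinj bh.
Qed.

(** Dividing all entries by the one at [ord0] kills exactly the diagonal; a preimage is obtained by
    putting 1 at [ord0]. *)
Lemma power_mod_diag_isomorphic (T : groupType)
    (abT : forall x y : T, (x * y = y * x)%g) (k : nat) : (0 < k)%N ->
  isomorphic (quotient_group (diag_subgroup abT k)) {ffun 'I_k.-1 -> T}.
Proof.
case: k => [//|k] _ /=.
pose f (t : {ffun 'I_k.+1 -> T}) :=
  [ffun i : 'I_k => ((t ord0)^-1 * t (lift ord0 i))%g].
apply: (@quotient_isomorphic _ _ _ (fun t s => f t = s))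
  => [t|s|t t' s s' <- <-|t s <-].
- by exists (f t).
- exists [ffun i => if unlift ord0 i is Some j then s j else 1%g].
  by apply/ffunP=> i; rewrite !ffunE unlift_none liftK invg1 mul1g.
- have CA (x y z : T) : (x * (y * z) = y * (x * z))%g by rewrite !mulgA (abT x).
  by apply/ffunP=> i; rewrite !ffunE invgM -!mulgA CA (CA (t' _)^-1%g).
split=> [/asboolP[x ->]|f1]; first by apply/ffunP=> i; rewrite !ffunE mulVg.
apply/asboolP; exists (t ord0); apply/ffunP=> i; rewrite ffunE.
case: (unliftP ord0 i) => [j|] -> //.
have /ffunP/(_ j) := f1; rewrite !ffunE => /(canRL (mulVKg _)).
by rewrite mulg1.
Qed.

Lemma gact_inv (H N : groupType) (a : group_action H N) x :
  {morph a x : n / (n^-1)%g}.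
Proof.
have a1 : a x 1%g = 1%g by apply: (mulgI (a x 1%g)); rewrite -gact_morph !mulg1.
by move=> n; apply: (mulgI (a x n)); rewrite -gact_morph !mulgV.
Qed.

Lemma alg_aut_ex (F : fieldType) (R : algType F) (f g : R -> R) :
    cancel f g -> cancel g f ->
    (forall c x y, f (c *: x + y) = c *: f x + f y) ->
    (forall x y, f (x * y) = f x * f y) -> f 1 = 1 ->
  exists f' : alg_aut R, forall x, f' x = f x.
Proof.
move=> fg gf fL fM f1.
have fD : zmod_morphism f.
  by move=> x y; rewrite -scaleN1r addrC fL scaleN1r addrC.
have fZ : scalable f.
  have f0 : f 0 = 0 by have := fD 0 0; rewrite !subrr.
  by move=> c x; rewrite -[c *: x]addr0 fL f0 addr0.
pose B := GRing.isZmodMorphism.Build _ _ f fD.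
pose C := GRing.isMonoidMorphism.Build _ _ f (conj f1 fM).
pose E := GRing.isScalable.Build _ _ _ _ f fZ.
pose f' : {lrmorphism R -> R} := HB.pack f B C E.
by exists (@AlgAut _ _ f' (Bijective fg gf)).
Qed.

(** * Automorphisms and homogeneous components *)

Section GradedAutomorphisms.
Variables (G : groupType) (F : fieldType) (R : algType F) (Gamma : grading G R).

Lemma hcomp_sum g (I : Type) (s : seq I) (P : pred I) (w : I -> R) :
  (forall i, P i -> Gamma g (w i)) -> Gamma g (\sum_(i <- s | P i) w i).
Proof.
move=> Pw; elim/big_ind: _ => // [|x y gx gy]; first exact: hcomp0.
by rewrite -[x]scale1r; apply: hcompZD.
Qed.

Lemma self_equivalenceP (f : alg_aut R) :
  f \in self_equivalence Gamma <->
  forall g, exists g', forall x, Gamma g x <-> Gamma g' (f x).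
Proof.
split=> [/asboolP fP g|fP].
  have [g' fg] := fP g; exists g' => x; rewrite -fg.
  by split=> [gx|[y gy /(bij_inj (aut_bij f)) <-]//]; exists x.
apply/asboolP => g; have [g' fg] := fP g; exists g'.
apply/seteqP; split=> [_ [x /fg gx <-]//|y].
by rewrite -(aut_invKV f y) => /fg gy; exists (aut_inv f y).
Qed.

(** One inclusion suffices: an automorphism that preserves degrees commutes with the homogeneous
    projections, so the preimage of a homogeneous element equals its own component of that
    degree. *)
Lemma stab_gradingP (f : aut_grading Gamma) :
  f \in stab_grading Gamma <-> forall g x, Gamma g x -> Gamma g (val f x).
Proof.
split=> [/asboolP fP g x gx|fP]; first by rewrite -fP; exists x.
apply/asboolP => g; apply/seteqP; split=> [_ [x gx <-]|y]; first exact: fP.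
rewrite -(aut_invKV (val f) y); set x := aut_inv _ y => gfx; exists x => //.
have dG := hcomp_direct Gamma; have w0 := hcomp0 Gamma.
have wB := @hcompB _ _ _ Gamma.
have sh j : proj w0 dG (val f x) j = val f (proj w0 dG x j).
  by apply: (@proj_shift _ _ _ _ _ _ dG dG w0 w0 wB (val f) id id).
suff -> : x = proj w0 dG x g by apply: proj_in.
apply: (bij_inj (aut_bij (val f))); rewrite -sh proj_id //.
Qed.

Lemma hcomp_support u x : Gamma u x -> x != 0 -> u \in Defs.support Gamma.
Proof. by move=> ux x0; apply/asboolP; exists x. Qed.

Lemma hcomp_offP u x : u \notin Defs.support Gamma -> Gamma u x <-> x = 0.
Proof.
move=> uS; split=> [ux|->]; last exact: hcomp0.
by apply/eqP; apply: contraNT uS; apply: hcomp_support.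
Qed.

End GradedAutomorphisms.

(** * The Weyl group of a matrix algebra with fine grading *)

Section GradedMatrixAlgebra.
Variables (G : groupType) (hG : forall g h : G, (g * h)%g = (h * g)%g).
Variables (F : fieldType) (D : algType F).
Variables (Gamma0 : grading G D) (hD : graded_division Gamma0).
Variables (k : nat) (i0 : 'I_k) (h : 'I_k -> G).
Hypothesis fine_h : forall i j a b, i != j -> (i, j) != (a, b) ->
  ~ coset_eq Gamma0 (h i * (h j)^-1)%g (h a * (h b)^-1)%g.
(** [R] is an abstract copy of the k x k matrices over [D], known only through its entries;
    endomorphisms are put in this form later. *)
Variables (R : algType F) (Gamma : grading G R).
Variables (ent : R -> 'I_k -> 'I_k -> D) (mk : ('I_k -> 'I_k -> D) -> R).
Hypothesis ent_mk : forall m i j, ent (mk m) i j = m i j.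
Hypothesis ent_inj : forall r s, (forall i j, ent r i j = ent s i j) -> r = s.
Hypothesis entZD : forall c r s i j,
  ent (c *: r + s) i j = c *: ent r i j + ent s i j.
Hypothesis ent1 : forall i j, ent 1 i j = (i == j)%:R.
Hypothesis entM : forall r s i j,
  ent (r * s) i j = \sum_l ent r i l * ent s l j.
Hypothesis entP : forall g r,
  Gamma g r <-> forall i j, Gamma0 ((h i)^-1 * g * h j)%g (ent r i j).

Local Notation T := (support_group hD).
Local Notation W := (weyl_group Gamma0).
Local Notation abT := (support_group_comm (hD := hD) hG).
Local Notation wact := (@weyl_act _ _ _ _ hD).

Let gAC (x y z : G) : (x * y * z = x * z * y)%g.
Proof. by rewrite -!mulgA (hG y). Qed.

(** With [z] the component of [v] of degree [g^-1], the product [u * z] is the component of degree 1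
    of [u * v = 1]. Hence [z] is itself the inverse of [u]. *)
Lemma unit_support g u v : Gamma0 g u -> u * v = 1 -> v * u = 1 ->
  Gamma0 (g^-1)%g v.
Proof.
move=> gu uv vu.
pose z := proj (hcomp0 _) (hcomp_direct Gamma0) v (g^-1)%g.
suff <- : z = v by apply: proj_in.
suff uz : u * z = 1 by rewrite -[RHS]mulr1 -uz mulrA vu mul1r.
have := proj_mull 1%g v gu; rewrite uv mulg1 => <-.
by apply: proj_id; [exact: hcompB|exact: hcomp_1].
Qed.

Lemma support_pick (t : T) : exists u v,
  [/\ Gamma0 (val t) u, Gamma0 (val t)^-1%g v, u * v = 1, v * u = 1 & u != 0].
Proof.
have /asboolP[u tu u0] := valP t; have [v [uv vu]] := hD tu u0.
by exists u, v; split=> //; apply: unit_support uv vu.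
Qed.

(** Components with degree outside the support are zero, so fixing every degree in T already means
    stabilising the grading. *)
Lemma weyl_act_faithful (w : W) : (forall t, wact w t = t) -> w = 1%g.
Proof.
elim/quotW: w => f w1; symmetry; apply/coset_eqP; rewrite invg1 mul1g.
apply/stab_gradingP => g x gx; have [->|x0] := eqVneq x 0.
  by rewrite raddf0; apply: hcomp0.
have gT := hcomp_support gx x0.
have := image_degreeP f (Sub g gT : T); rewrite -weyl_act_pi w1 /= => <-.
by exists x.
Qed.

Lemma hcomp_degreeP (f : aut_grading Gamma0) (t : T) x :
  Gamma0 (val (image_degree f t)) (val f x) <-> Gamma0 (val t) x.
Proof.
rewrite -image_degreeP; split=> [[y ty /(bij_inj (aut_bij _)) <-]//|tx].
by exists x.
Qed.

Lemma ent0 i j : ent 0 i j = 0.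
Proof.
have /eqP := entZD 1 0 0 i j; rewrite scaler0 addr0 scale1r.
by rewrite -[X in X == _]addr0 (inj_eq (addrI _)) => /eqP.
Qed.

Lemma entD r s i j : ent (r + s) i j = ent r i j + ent s i j.
Proof. by have := entZD 1 r s i j; rewrite !scale1r. Qed.

(** * Elementary matrices E_ij d *)

Definition ematrix i j (d : D) : R :=
  mk (fun a b => if (a == i) && (b == j) then d else 0).

Lemma ent_ematrix i j d a b :
  ent (ematrix i j d) a b = if (a == i) && (b == j) then d else 0.
Proof. by rewrite ent_mk. Qed.

Lemma ent_ematrixid i j d : ent (ematrix i j d) i j = d.
Proof. by rewrite ent_ematrix !eqxx. Qed.

Lemma ematrix_inj i j : injective (ematrix i j).
Proof. by move=> d e /(congr1 (fun r => ent r i j)); rewrite !ent_ematrixid. Qed.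

Lemma ematrix_eq0 i j d : (ematrix i j d == 0) = (d == 0).
Proof.
have E0 : ematrix i j 0 = 0.
  by apply: ent_inj => a b; rewrite ent_ematrix ent0 if_same.
by apply/eqP/eqP => [|->//]; rewrite -{1}E0; apply: ematrix_inj.
Qed.

Lemma ematrix_linear i j c d e :
  ematrix i j (c *: d + e) = c *: ematrix i j d + ematrix i j e.
Proof.
apply: ent_inj => a b; rewrite entZD !ent_ematrix.
by case: ifP; rewrite // scaler0 addr0.
Qed.

Lemma ent_ematrixM i l d r a b :
  ent (ematrix i l d * r) a b = if a == i then d * ent r l b else 0.
Proof.
rewrite entM (bigD1 l) //= big1 => [|m ml].
  by rewrite addr0 ent_ematrix eqxx andbT; case: ifP; rewrite ?mul0r.
by rewrite ent_ematrix (negbTE ml) andbF mul0r.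
Qed.

Lemma ematrix_mul i j l d e : ematrix i j d * ematrix j l e = ematrix i l (d * e).
Proof.
apply: ent_inj => a b; rewrite ent_ematrixM !ent_ematrix eqxx /=.
by case: (a == i) => //=; case: ifP; rewrite ?mulr0.
Qed.

Lemma ematrix_mul0 i j a l d e : j != a -> ematrix i j d * ematrix a l e = 0.
Proof.
move=> /negbTE ja; apply: ent_inj => x y.
by rewrite ent_ematrixM ent_ematrix ja mulr0 ent0 if_same.
Qed.

(** Peirce decomposition: the diagonal idempotents cut out single entries, so an automorphism that
    permutes them permutes the blocks E_ij D. *)
Lemma ematrix_sandwich i j r :
  ematrix i i 1 * r * ematrix j j 1 = ematrix i j (ent r i j).
Proof.
apply: ent_inj => a b; rewrite -mulrA ent_ematrixM ent_ematrix mul1r.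
case: (a == i) => //=; rewrite entM (bigD1 j) //= big1 => [|m mj].
  by rewrite addr0 ent_ematrix eqxx /=; case: ifP; rewrite ?mulr1 ?mulr0.
by rewrite ent_ematrix (negbTE mj) mulr0.
Qed.

Lemma ematrix_homogP i j g d :
  Gamma g (ematrix i j d) <-> Gamma0 ((h i)^-1 * g * h j)%g d.
Proof.
split=> [/entP/(_ i j)|gd]; first by rewrite ent_ematrixid.
apply/entP => a b; rewrite ent_ematrix.
case: (a =P i) => [->|_] /=; last exact: hcomp0.
by case: (b =P j) => [->|_] //=; exact: hcomp0.
Qed.

Lemma ematrix_homog i j g d :
  Gamma0 g d -> Gamma (h i * g * (h j)^-1)%g (ematrix i j d).
Proof. by move=> gd; apply/ematrix_homogP; rewrite !mulgA mulVg mul1g mulgVK. Qed.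

Lemma ent_sum I (r : seq I) (w : I -> R) i j :
  ent (\sum_(l <- r) w l) i j = \sum_(l <- r) ent (w l) i j.
Proof.
exact: (big_morph (fun r => ent r i j) (fun x y => entD x y i j) (ent0 i j)).
Qed.

Lemma sum_ematrix r : r = \sum_i \sum_j ematrix i j (ent r i j).
Proof.
apply: ent_inj => a b; rewrite ent_sum (bigD1 a) //= [X in _ + X]big1.
  rewrite addr0 ent_sum (bigD1 b) //= big1 => [|j jb].
    by rewrite addr0 ent_ematrixid.
  by rewrite ent_ematrix eq_sym (negbTE jb) andbF.
move=> i ia; rewrite ent_sum big1 // => j _.
by rewrite ent_ematrix eq_sym (negbTE ia).
Qed.

(** The fine condition for the pairs (i, j) and (i, i). It makes every matrix of degree 1
    diagonal. *)
Lemma fine_disjoint i j : i != j -> ((h i)^-1 * h j)%g \notin Defs.support Gamma0.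
Proof.
move=> ij; apply/negP => ijT; have ii : (i, j) != (i, i).
  by apply: contra ij => /eqP[->].
by apply: (fine_h ij ii); rewrite /coset_eq mulgV mulg1 invgM invgK hG.
Qed.

(* psi maps the space ematrix_ij D_t into E_(pi i)(pi j) D_t' with
   t' = tau_(pi i) alpha(t) tau_(pi j)^-1 *)
Definition moves (psi : R -> R) (tau : {ffun 'I_k -> T}) (pi : 'I_k -> 'I_k)
    (alpha : T -> T) : Prop :=
  forall i j (t : T) d, Gamma0 (val t) d -> exists2 d',
    Gamma0 (val (tau (pi i) * alpha t * (tau (pi j))^-1)%g) d' &
    psi (ematrix i j d) = ematrix (pi i) (pi j) d'.

(** The relation handed to [quotient_isomorphic]. The tuple is quantified existentially because
    [psi] determines it only modulo the diagonal. *)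
Definition moves_sd (psi : aut_grading Gamma)
    (p : sdprod_group (power_mod_diag_action abT k (weyl_action hD))) : Prop :=
  exists2 tau, p.1 = (\pi_(quotient_group (diag_subgroup abT k))%qT tau) &
    moves (val psi) tau (p.2.1 : 'S_k) (wact p.2.2).

Lemma moves_sdM psi psi' p p' : moves_sd psi p -> moves_sd psi' p' ->
  moves_sd (psi * psi')%g (p * p')%g.
Proof.
(* Applying [psi'] first, index [s (s' i)] collects [tau (s (s' i))] and the [w]-image of
   [tau' (s' i)]: this is the semidirect multiplication on representatives. *)
case: p p' => [q [s w]] [q' [s' w']] [tau /= -> m] [tau' /= -> m'].
exists (tau * power_action k (weyl_action hD) (s, w) tau')%g.
  rewrite /= (quot_act_pi (@power_action_diag _ abT k _ (weyl_action hD))).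
  exact: Defs.pi_mul.
move=> i j t d td /=; have [d1 td1 e1] := m' i j t d td.
have [d2 td2 e2] := m (s' i) (s' j) _ d1 td1.
exists d2; last by rewrite e1 e2 !permM.
move: td2; rewrite !permM /= !ffunE /= !permK.
have wV u : wact w (u^-1)%g = (wact w u)^-1%g := gact_inv (weyl_action hD) w u.
rewrite weyl_actM !weyl_act_morph wV.
by rewrite invgM !mulgA.
Qed.
Lemma moves_sd_stab psi p : moves_sd psi p ->
  (psi \in stab_grading Gamma <-> p = 1%g).
Proof.
case: p => [q [s w]] [tau /= -> m].
split=> [/stab_gradingP psiS|[]]; last first.
  (* For [p = 1] the tuple is a constant [x], which cancels from [x t x^-1] as T is abelian, so
     entries keep position and degree. *)
  move=> /esym/coset_eqP; rewrite invg1 mul1g.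
  move=> /asboolP[x xE] s1 w1; subst tau s w.
  apply/stab_gradingP => g r gr; rewrite [r]sum_ematrix raddf_sum.
  apply: hcomp_sum => i _; rewrite raddf_sum; apply: hcomp_sum => j _.
  have gij := (entP g r).1 gr i j; set d := ent r i j in gij *.
  have [->|d0] := eqVneq d 0.
    have -> : ematrix i j 0 = 0 by apply/eqP; rewrite ematrix_eq0.
    by rewrite raddf0; apply: hcomp0.
  have [d' td' e] :=
    m i j (Sub ((h i)^-1 * g * h j)%g (hcomp_support gij d0) : T) d gij.
  rewrite [X in Gamma g X]e !perm1; apply/ematrix_homogP; move: td'.
  by rewrite !ffunE weyl_act1 abT mulKg.
(* Two expressions for the degree of the nonzero element [psi (E_ij u)]: the one predicted by
   [moves], and the original one, since [psi] stabilises. *)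
have key i j t : (h (s i) * val (tau (s i) * wact w t * (tau (s j))^-1)
    * (h (s j))^-1 = h i * val t * (h j)^-1)%g.
  have [u [_ [tu _ _ _ u0]]] := support_pick t.
  have [d' td' e] := m i j t u tu.
  apply: (hcomp_neq (Gamma := Gamma) (x := val psi (ematrix i j u))).
  - by rewrite e; apply: ematrix_homog.
  - by apply: psiS; apply: ematrix_homog.
  - by rewrite -(raddf0 (val psi)) (bij_eq (aut_bij (val psi))) ematrix_eq0.
(* If some [j] differs from [i], then [key] at t = 1 makes the quotients for (i, j) and (s i, s j)
   congruent modulo T, and the fine condition identifies the pairs. Otherwise [i] is the only
   index. *)
have s1 i : s i = i.
  have [[j ij]|nj] := pselect (exists j, i != j); last first.
    by apply/eqP/contraT => si; case: nj; exists (s i); rewrite eq_sym.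
  have := key i j 1%g; set t := (_ * _ * _ : T)%g => e.
  have [[]//|ne] := eqVneq (s i, s j) (i, j).
  case: (@fine_h i j (s i) (s j) ij); first by rewrite eq_sym.
  rewrite /coset_eq.
  have -> : ((h i / h j)^-1 * (h (s i) / h (s j)) = val t^-1)%g.
    have -> : (h i / h j = h (s i) / h (s j) * val t)%g.
      by rewrite gAC e mulg1.
    by rewrite invgM -mulgA mulVg mulg1.
  exact: valP.
have w1 : w = 1%g.
  apply: weyl_act_faithful => t; apply: val_inj; have := key i0 i0 t.
  by rewrite s1 => /mulIg/mulgI; rewrite abT mulKg.
have tauE i j : tau i = tau j.
  have := key i j 1%g; rewrite !s1 w1 weyl_act1 mulg1 => /mulIg/mulgI/val_inj.
  by move=> /(canRL (mulgVK _)); rewrite mul1g.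
congr (_, (_, _)) => //; last by apply/permP => i; rewrite s1 perm1.
symmetry; apply/coset_eqP; rewrite invg1 mul1g; apply/asboolP.
by exists (tau i0); apply/ffunP => i; rewrite ffunE; apply: tauE.
Qed.

(** * Realising every element of the semidirect product *)

Definition unit_in (t : T) (u v : D) : Prop :=
  [/\ Gamma0 (val t) u, Gamma0 (val t)^-1%g v, u * v = 1 & v * u = 1].

Lemma hcomp_unitMP (s t : T) u v u' v' g x :
    unit_in s u v -> unit_in t u' v' ->
  Gamma0 g (u * x * v') <-> Gamma0 ((val s)^-1 * g * val t)%g x.
Proof.
move=> [su sv uv vu] [tu tv uv' vu']; split=> gx.
  have -> : x = v * (u * x * v') * u'.
    by rewrite !mulrA vu mul1r -mulrA vu' mulr1.
  by apply: hcompM => //; apply: hcompM.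
have -> : g = (val s * ((val s)^-1 * g * val t) * (val t)^-1)%g.
  by rewrite !mulgA mulgV mul1g mulgK.
by apply: hcompM => //; apply: hcompM.
Qed.

(** The degree in question is that of entry (i, j) of a matrix of degree K_a t K_b^-1. The family
    [K] is arbitrary because both [h] and its shift by a tuple are needed. *)
Lemma fine_support (K : 'I_k -> G) a b i j (t : T) :
    (forall i j a b, i != j -> (i, j) != (a, b) ->
      ~ coset_eq Gamma0 (K i * (K j)^-1)%g (K a * (K b)^-1)%g) ->
    (i, j) != (a, b) -> (a != b) || (i != j) ->
  ((K i)^-1 * (K a * val t * (K b)^-1) * K j)%g \notin Defs.support Gamma0.
Proof.
move=> fK ne ab_ij.
have -> : ((K i)^-1 * (K a * val t * (K b)^-1) * K j =
    (K i / K j)^-1 * (K a / K b) * val t)%g.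
  rewrite invgM invgK (hG _ (K j)) !mulgA; exact: gAC.
set x := (_ / _)%g; set y := (_ / _)%g; apply/negP => xyT.
have [S1 SB] := support_closed hD.
have xyT' : (x^-1 * y)%g \in Defs.support Gamma0.
  by have := SB _ _ xyT (valP t); rewrite mulgK.
(* The first pair in the fine condition must be off-diagonal; if that is (a, b) rather than (i, j),
   the congruence is inverted. *)
case/orP: ab_ij => [ab|ij]; last exact: (fK _ _ _ _ ij ne).
apply: (fK _ _ i j ab); first by rewrite eq_sym.
by rewrite /coset_eq -/x -/y; have := SB _ _ S1 xyT'; rewrite mul1g invgM invgK.
Qed.

Lemma moves_sd_surj p : exists psi, moves_sd psi p.
Proof.
case: p => [q [s w]]; elim/quotW: q => tau; elim/quotW: w => f.
have /choice[u /choice[v uv]] : forall i, exists u v, unit_in (tau i) u v.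
  by move=> i; have [u [v [? ? ? ? _]]] := support_pick (tau i); exists u, v.
have vu1 i : v i * u i = 1 by case: (uv i).
have uv1 i : u i * v i = 1 by case: (uv i).
(* Conjugation by the semilinear map in matrix form: entry (s i, s j) becomes u_(s i) psi_0(r_ij)
   v_(s j), where [v] is inverse to [u]. *)
pose F1 (r : R) := mk (fun i j =>
  u i * val f (ent r ((s : 'S_k)^-1%g i) ((s : 'S_k)^-1%g j)) * v j).
pose F2 (r : R) := mk (fun i j =>
  aut_inv (val f) (v (s i) * ent r (s i) (s j) * u (s j))).
have ent1s r i j :
    ent (F1 r) (s i) (s j) = u (s i) * val f (ent r i j) * v (s j).
  by rewrite ent_mk !permK.
have F12 : cancel F1 F2.
  move=> r; apply: ent_inj => i j; rewrite ent_mk ent1s !mulrA vu1 mul1r.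
  by rewrite -mulrA vu1 mulr1 aut_invK.
have F21 : cancel F2 F1.
  move=> r; apply: ent_inj => i j; rewrite ent_mk ent_mk !permKV aut_invKV.
  by rewrite !mulrA uv1 mul1r -mulrA uv1 mulr1.
have F1L c x y : F1 (c *: x + y) = c *: F1 x + F1 y.
  apply: ent_inj => i j; rewrite entZD !ent_mk entZD linearP mulrDr mulrDl.
  by rewrite -scalerAr -scalerAl.
have F1M x y : F1 (x * y) = F1 x * F1 y.
  apply: ent_inj => i j; rewrite entM ent_mk entM raddf_sum mulr_sumr mulr_suml.
  rewrite [RHS](reindex_perm s) /=; apply: eq_bigr => l _.
  rewrite !ent_mk permK rmorphM !mulrA; congr (_ * _ * _).
  by rewrite -!mulrA vu1 mulr1.
have F11 : F1 1 = 1.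
  apply: ent_inj => i j; rewrite ent_mk !ent1 (inj_eq perm_inj).
  by case: eqP => [->|_]; rewrite ?rmorph1 ?rmorph0 ?mulr1 ?uv1 // mulr0 mul0r.
have [psi psiE] := alg_aut_ex F12 F21 F1L F1M F11.
(* The degree of b_(s i) u_(s i), the image of b_i under the semilinear map; replacing [h] by [H]
   absorbs the units. *)
have [H HH] : exists H : 'I_k -> G,
    forall i, H i = (h (s i) * val (tau (s i)))%g.
  by exists (fun i => h (s i) * val (tau (s i)))%g.
have [S1 SB] := support_closed hD.
have tT i j : (val (tau i) / val (tau j))%g \in Defs.support Gamma0.
  exact: (valP (tau i / tau j)%g).
have HE i j : (H i / H j =
    h (s i) / h (s j) * (val (tau (s i)) / val (tau (s j))))%g.
  by rewrite !HH invgM !mulgA gAC (gAC _ _ (h (s j))^-1%g).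
(* The quotients of [H] differ from those of [h \o s] by elements of T. *)
have fine_H i j a b : i != j -> (i, j) != (a, b) ->
    ~ coset_eq Gamma0 (H i * (H j)^-1)%g (H a * (H b)^-1)%g.
  move=> ij ne; apply: contra_not (@fine_h (s i) (s j) (s a) (s b) _ _).
  - rewrite /coset_eq !HE invgM.
    set x := (h _ / _)%g; set y := (h _ / _)%g.
    set p := (val _ / _)%g; have pT : p \in Defs.support Gamma0 := tT _ _.
    set q := (val _ / _)%g; have qT : q \in Defs.support Gamma0 := tT _ _.
    rewrite mulgA => /SB/(_ qT); rewrite mulgK -mulgA.
    by have := SB _ _ S1 pT; rewrite mul1g => pV /SB/(_ pV); rewrite hG mulKg.
  - by rewrite (inj_eq perm_inj).
  - by apply: contra ne => /eqP[/perm_inj-> /perm_inj->].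
have degs g : exists g', forall i j x,
    Gamma0 ((h i)^-1 * g * h j)%g x <->
    Gamma0 ((H i)^-1 * g' * H j)%g (val f x).
  have f0 x : val f x = 0 <-> x = 0.
    by rewrite -{1}(raddf0 (val f)); split=> [/(bij_inj (aut_bij _))//|->].
  (* If entry (a, b) can be nonzero in degree [g], it dictates [g']. Any other entry vanishes on
     both sides, unless both positions are diagonal, and then they carry the same degree. *)
  have [[a [b gT]]|nT] := pselect (exists a b,
    ((h a)^-1 * g * h b)%g \in Defs.support Gamma0).
    have [t tE] : exists t : T, val t = ((h a)^-1 * g * h b)%g
      by exists (Sub ((h a)^-1 * g * h b)%g gT).
    have gE : g = (h a * val t * (h b)^-1)%g.
      by rewrite tE !mulgA mulgV mul1g mulgK.
    exists (H a * val (image_degree f t) * (H b)^-1)%g => i j x; rewrite {}gE.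
    have [[-> ->]|ne] := eqVneq (i, j) (a, b).
      by rewrite !mulgA !mulVg !mul1g !mulgVK; symmetry; apply: hcomp_degreeP.
    have [|/norP[/negPn/eqP ab /negPn/eqP ij]] := boolP ((a != b) || (i != j)).
      move=> ab_ij.
      have o1 := hcomp_offP x (fine_support t fine_h ne ab_ij).
      have o2 := hcomp_offP (val f x)
        (fine_support (image_degree f t) fine_H ne ab_ij).
      by split=> [/o1/f0/o2|/o2/f0/o1].
    rewrite -ab -ij !(gAC _ _ (h i)) !(gAC _ _ (H i)) !mulVg !mul1g.
    by rewrite !(gAC _ (val _)) !mulgV !mul1g; symmetry; apply: hcomp_degreeP.
  have hT i j : ((h i)^-1 * g * h j)%g \notin Defs.support Gamma0.
    by apply/negP => gT; apply: nT; exists i, j.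
  (* No entry can be nonzero in degree [g]; since [H] and [h \o s] agree modulo T, the same holds
     for [H], and [g' = g] serves. *)
  have HT i j : ((H i)^-1 * g * H j)%g \notin Defs.support Gamma0.
    apply: contra (hT (s i) (s j)) => /SB/(_ (tT (s j) (s i))).
    set x := (_ / _)%g; set y := (X in _ -> X \in _); have -> // : x = y.
    rewrite {}/x {}/y !HH !invgM invgK !mulgA.
    rewrite (gAC _ (val (tau (s j)))) mulgK (hG _ (val (tau (s i)))).
    by rewrite -!mulgA mulVKg.
  exists g => i j x; have o1 := hcomp_offP x (hT i j).
  have o2 := hcomp_offP (val f x) (HT i j).
  by split=> [/o1/f0/o2|/o2/f0/o1].
have psiS : psi \in self_equivalence Gamma.
  apply/self_equivalenceP => g; have [g' gg'] := degs g; exists g' => r.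
  rewrite psiE; split=> [/entP gr|/entP gr]; apply/entP => i j.
    rewrite -(permKV s i) -(permKV s j) ent1s.
    apply/(hcomp_unitMP _ _ (uv _) (uv _)).
    have := (gg' _ _ _).1 (gr ((s : 'S_k)^-1%g i) ((s : 'S_k)^-1%g j)).
    by rewrite !HH invgM !mulgA.
  apply/gg'; have := gr (s i) (s j); rewrite ent1s.
  by move=> /(hcomp_unitMP _ _ (uv _) (uv _)); rewrite !HH invgM !mulgA.
exists (Sub psi psiS), tau => // i j t d td.
exists (u (s i) * val f d * v (s j)).
  rewrite weyl_act_pi; have [su _ _ _] := uv (s i); have [_ sv _ _] := uv (s j).
  by do 2!apply: hcompM => //; apply/hcomp_degreeP.
rewrite SubK psiE; apply: ent_inj => a b.
rewrite ent_mk !ent_ematrix !(can2_eq (permKV s) (permK s)).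
case: (a =P s i) => [->|_] /=; last by rewrite raddf0 mulr0 mul0r.
by case: (b =P s j) => [->|_] //=; rewrite raddf0 mulr0 mul0r.
Qed.

(** * Reading the triple off a self-equivalence *)

Lemma hcomp1_idempotent d : Gamma0 1%g d -> d * d = d -> d != 0 -> d = 1.
Proof.
move=> d1 dd d0; have [d' [_ d'd]] := hD d1 d0.
by rewrite -d'd -{2}dd mulrA d'd mul1r.
Qed.

(** The images of the E_ii are nonzero orthogonal idempotents of degree 1, hence diagonal with
    entries 0 or 1. Orthogonality gives them disjoint positions, and there are k of them for k
    positions. *)
Lemma idempotents_permuted (psi : aut_grading Gamma) :
  exists s : 'S_k, forall i, val psi (ematrix i i 1) = ematrix (s i) (s i) 1.
Proof.
have /self_equivalenceP := valP psi; set f := val psi => fP.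
(* The component of degree 1 is the one containing the unit, which [f] fixes. *)
have f1 r : Gamma 1%g r -> Gamma 1%g (f r).
  have [g fg] := fP 1%g; have /fg := hcomp_1 Gamma; rewrite rmorph1 => g1.
  by move/fg; rewrite (hcomp_neq g1 (hcomp_1 Gamma) (oner_neq0 R)).
have ff a b : f a = f b -> a = b by apply: (bij_inj (aut_bij f)).
pose e i a := ent (f (ematrix i i 1)) a a.
have fE1 i : Gamma 1%g (f (ematrix i i 1)).
  by apply: f1; apply/ematrix_homogP; rewrite mulg1 mulVg; apply: hcomp_1.
have off i a b : a != b -> ent (f (ematrix i i 1)) a b = 0.
  move=> ab; apply/(hcomp_offP _ (fine_disjoint ab)).
  by have /entP/(_ a b) := fE1 i; rewrite mulg1.
have e1 i a : Gamma0 1%g (e i a).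
  by have /entP/(_ a a) := fE1 i; rewrite mulg1 mulVg.
have eM i j a : e i a * e j a = if i == j then e i a else 0.
  have -> : e i a * e j a = ent (f (ematrix i i 1 * ematrix j j 1)) a a.
    rewrite rmorphM entM (bigD1 a) //= big1 ?addr0 // => l la.
    by rewrite (off i) ?mul0r // eq_sym.
  case: eqP => [<-|/eqP ij]; first by rewrite ematrix_mul mulr1.
  by rewrite ematrix_mul0 // raddf0 ent0.
have e01 i a : e i a != 0 -> e i a = 1.
  by move=> e0; apply: hcomp1_idempotent => //; rewrite eM eqxx.
have /choice[p pP] : forall i, exists a, e i a != 0.
  move=> i; apply: contrapT => e0; have: ematrix i i 1 = 0.
    apply: ff; rewrite raddf0; apply: ent_inj => a b; rewrite ent0.
    have [->|/off->//] := eqVneq a b.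
    by apply: contrapT => /eqP eb; apply: e0; exists b.
  by move/eqP; rewrite ematrix_eq0 oner_eq0.
have pI : injective p.
  move=> i j pij; apply/eqP/contraT => ij; have := eM i j (p i).
  rewrite (negbTE ij) (e01 _ _ (pP i)) pij (e01 _ _ (pP j)) mul1r => /eqP.
  by rewrite oner_eq0.
exists (perm pI) => i; apply: ent_inj => a b; rewrite ent_ematrix !permE.
have [<-|ab] := eqVneq a b; last first.
  rewrite off //; case: eqP => //= ai; case: eqP => //= bi.
  by rewrite ai bi eqxx in ab.
have [->|ai] /= := eqVneq a (p i); first exact: e01 (pP i).
(* Position [a] is occupied by the image of E_jj with [j] different from [i], so orthogonality kills
   the entry there. *)
pose j := (perm pI)^-1%g a.
have aE : a = p j by rewrite -[p j](permE pI) permKV.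
have ij : i != j by apply: contra ai => /eqP->; rewrite aE.
by have := eM i j a; rewrite (negbTE ij) aE (e01 _ _ (pP j)) mulr1.
Qed.

(** Multiplicativity ties all blocks E_ij D to the corner at [i0], so one automorphism of [D] and
    one degree per index describe [psi]. *)
Lemma moves_sd_total psi : exists p, moves_sd psi p.
Proof.
have [s sP] := idempotents_permuted psi.
have /self_equivalenceP := valP psi; set f := val psi in sP * => fP.
have fM a b : f (a * b) = f a * f b by apply: rmorphM.
pose phi i j d := ent (f (ematrix i j d)) (s i) (s j).
have fE i j d : f (ematrix i j d) = ematrix (s i) (s j) (phi i j d).
  by rewrite -ematrix_sandwich -!sP -!fM !ematrix_mul mul1r mulr1.
have phiM i j l d e : phi i l (d * e) = phi i j d * phi j l e.
  apply: (@ematrix_inj (s i) (s l)).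
  by rewrite -fE -(ematrix_mul _ j) fM !fE ematrix_mul.
have phi1 i : phi i i 1 = 1 by apply: (@ematrix_inj (s i) (s i)); rewrite -fE.
have phi_deg i j g : exists g', forall d, Gamma0 g d <-> Gamma0 g' (phi i j d).
  have [g' gg'] := fP (h i * g * (h j)^-1)%g.
  exists ((h (s i))^-1 * g' * h (s j))%g => d.
  rewrite -ematrix_homogP -fE -gg' ematrix_homogP.
  by rewrite !mulgA mulVg mul1g mulgVK.
(* The corner of the inverse of [f] inverts the corner of [f]. *)
pose phi' d := ent (aut_inv f (ematrix (s i0) (s i0) d)) i0 i0.
have phiK : cancel (phi i0 i0) phi'.
  by move=> d; rewrite /phi' -fE aut_invK ent_ematrixid.
have phi'K : cancel phi' (phi i0 i0).
  move=> d; apply: (@ematrix_inj (s i0) (s i0)).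
  rewrite -fE -ematrix_sandwich !fM !sP aut_invKV.
  by rewrite !ematrix_mul mul1r mulr1.
have phiL c x y : phi i0 i0 (c *: x + y) = c *: phi i0 i0 x + phi i0 i0 y.
  by rewrite /phi ematrix_linear linearP entZD.
have [f0 f0E] := alg_aut_ex phiK phi'K phiL (phiM i0 i0 i0) (phi1 i0).
have f0S : f0 \in self_equivalence Gamma0.
  apply/self_equivalenceP => g; have [g' gg'] := phi_deg i0 i0 g.
  by exists g' => x; rewrite f0E.
pose f0' : aut_grading Gamma0 := Sub f0 f0S.
have phiV i j : phi i j 1 * phi j i 1 = 1 by rewrite -phiM mulr1.
(* This entry is invertible by [phiV], hence nonzero, so its degree lies in T. *)
have /choice[t tP] : forall i, exists t : T, Gamma0 (val t) (phi i i0 1).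
  move=> i; have [g gg'] := phi_deg i i0 1%g.
  have gi := (gg' 1).1 (hcomp_1 Gamma0).
  have i1 : phi i i0 1 != 0.
    apply/eqP => i1; have /eqP := phiV i i0; rewrite i1 mul0r eq_sym.
    by rewrite oner_eq0.
  by exists (Sub g (hcomp_support gi i1)).
pose tau : {ffun 'I_k -> T} := [ffun m => t ((s : 'S_k)^-1%g m)].
exists (\pi_(quotient_group (diag_subgroup abT k))%qT tau,
  (s : sym_group k, \pi_(quotient_group (stab_grading Gamma0))%qT f0')).
exists tau => // i j u d ud; exists (phi i j d) => //.
rewrite weyl_act_pi !ffunE /= !permK.
(* From E_ij d = E_(i i0) (E_(i0 i0) d) E_(i0 j); the outer factors have degrees [t i] and the
   inverse of [t j]. *)
have -> : phi i j d = phi i i0 1 * f0 d * phi i0 j 1.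
  by rewrite f0E -!phiM mul1r mulr1.
apply: hcompM; last exact: unit_support (tP j) (phiV j i0) (phiV i0 j).
apply: hcompM; first exact: tP.
exact: (hcomp_degreeP f0' u d).2.
Qed.

Theorem weyl_group_isomorphic : isomorphic (weyl_group Gamma)
  (sdprod_group (power_mod_diag_action abT k (weyl_action hD))).
Proof.
apply: quotient_isomorphic moves_sd_total moves_sd_surj _ moves_sd_stab.
exact: moves_sdM.
Qed.

End GradedMatrixAlgebra.

(** * Homogeneous bases and the fine condition *)

Section HomogeneousBasis.
Variables (G : groupType) (hG : forall g h : G, (g * h)%g = (h * g)%g).
Variables (F : fieldType) (D : algType F).
Variables (Gamma0 : grading G D) (hD : graded_division Gamma0).
Variables (V : lmodType D^c) (VG : module_grading Gamma0 V).
Variables (k : nat) (b : 'I_k -> V) (h : 'I_k -> G).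
Hypothesis b_homog : forall i, VG (h i) (b i).
Hypothesis b_basis : forall v,
  exists! c : {ffun 'I_k -> D}, v = \sum_i ract (b i) (c i).

Lemma mcompB g v w : VG g v -> VG g w -> VG g (v - w).
Proof.
move=> gv gw; have := mcompZD (-1) gw gv.
by rewrite /ract scaleN1r (scaleN1r w) addrC.
Qed.

Lemma mcomp_sum g (I : Type) (s : seq I) (P : pred I) (w : I -> V) :
  (forall i, P i -> VG g (w i)) -> VG g (\sum_(i <- s | P i) w i).
Proof.
move=> Pw; elim/big_ind: _ => // [|x y gx gy]; first exact: mcomp0.
by have := mcompZD 1 gx gy; rewrite /ract !scale1r.
Qed.

Lemma ractA (v : V) x y : ract (ract v x) y = ract v (x * y).
Proof. by rewrite /ract scalerA. Qed.

Lemma ract1 (v : V) : ract v 1 = v.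
Proof. by rewrite /ract scale1r. Qed.

Lemma ract_sum (I : Type) (s : seq I) (w : I -> V) x :
  ract (\sum_(i <- s) w i) x = \sum_(i <- s) ract (w i) x.
Proof. exact: scaler_sumr. Qed.

Lemma proj_ract u g v x : VG g v ->
  proj (mcomp0 VG) (mcomp_direct VG) (ract v x) u =
  ract v (proj (hcomp0 Gamma0) (hcomp_direct Gamma0) x (g^-1 * u)%g).
Proof.
move=> gv; rewrite -{1}(mulVKg g u).
apply: (@proj_shift _ _ _ _ _ _ _ _ (hcomp0 Gamma0) (mcomp0 VG) mcompB
  (@ract D V v) (fun l => g * l)%g (fun l => g^-1 * l)%g)
  => [l|l|l z lz]; rewrite ?mulKg ?mulVKg //.
exact: mcompM.
Qed.

Lemma basis_coordinates : exists c : V -> 'I_k -> D,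
  (forall v, v = \sum_i ract (b i) (c v i)) /\
  (forall v x, v = \sum_i ract (b i) (x i) -> c v =1 x).
Proof.
have /choice[c cP] : forall v, exists c : {ffun 'I_k -> D},
    v = \sum_i ract (b i) (c i) /\
    forall c' : {ffun 'I_k -> D}, v = \sum_i ract (b i) (c' i) -> c = c'.
  by move=> v; have [c [? ?]] := b_basis v; exists c.
exists (fun v => c v); split=> [v|v x vx i]; first by case: (cP v).
have [_ /(_ [ffun i => x i])->] := cP v; first by rewrite ffunE.
by rewrite {1}vx; apply: eq_bigr => j _; rewrite ffunE.
Qed.

Lemma sum_ract_single i x :
  \sum_l ract (b l) (if l == i then x else 0) = ract (b i) x.
Proof.
rewrite (bigD1 i) //= eqxx big1 ?addr0 // => l /negbTE->.
exact: raddf0.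
Qed.

Lemma basis_neq0 i : b i != 0.
Proof.
apply/eqP => bi0; have [c [_ cU]] := basis_coordinates.
have c1 := cU (b i) _ (esym (etrans (sum_ract_single i 1) (ract1 _))) i.
have zero : b i = \sum_l ract (b l) 0.
  by rewrite bi0 big1 // => l _; apply: raddf0.
by have /eqP := cU _ _ zero i; rewrite c1 eqxx oner_eq0.
Qed.

Lemma basis_not_multiple i j x : i != j -> b j <> ract (b i) x.
Proof.
move=> ij e; have [c [_ cU]] := basis_coordinates.
have := cU (b j) _ (esym (etrans (sum_ract_single j 1) (ract1 _))) j.
rewrite (cU _ _ (etrans e (esym (sum_ract_single i x)))) eqxx.
by rewrite eq_sym (negbTE ij) => /esym/eqP; rewrite oner_eq0.
Qed.

Lemma coset_eq_sym x y : coset_eq Gamma0 x y -> coset_eq Gamma0 y x.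
Proof.
have [S1 SB] := support_closed hD; rewrite /coset_eq => /(SB _ _ S1).
by rewrite mul1g invgM invgK.
Qed.

Lemma coset_eq_trans x y z :
  coset_eq Gamma0 x y -> coset_eq Gamma0 y z -> coset_eq Gamma0 x z.
Proof.
have [_ SB] := support_closed hD; move=> xy /coset_eq_sym zy.
by have := SB _ _ xy zy; rewrite invgM invgK mulgA mulgK.
Qed.

Lemma coset_eq_div x y x' y' : coset_eq Gamma0 x x' -> coset_eq Gamma0 y y' ->
  coset_eq Gamma0 (x * y^-1)%g (x' * y'^-1)%g.
Proof.
have [_ SB] := support_closed hD; move=> xx' yy'; have := SB _ _ xx' yy'.
by rewrite /coset_eq !invgM !invgK -!mulgA [X in _ -> X \in _]hG -!mulgA.
Qed.

(** Each b_i lies in one isotypic component, indexed by [m i]. One-dimensionality makes [m]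
    injective, and the fine condition is then carried along the congruences h_i = g_(m i) modulo
    T. *)
Lemma basis_fine : fine_condition VG ->
  forall i j a l, i != j -> (i, j) != (a, l) ->
    ~ coset_eq Gamma0 (h i * (h j)^-1)%g (h a * (h l)^-1)%g.
Proof.
case=> s [g [[gI gP] g1 fine]].
have b_iso i : isotypic VG (h i) (b i).
  exists [:: h i], (fun l => if l == h i then b i else 0); split=> [l|l|].
  - rewrite inE => /eqP->; rewrite /coset_eq mulVg.
    by case: (support_closed hD).
  - by case: eqP => [->|_] //; apply: mcomp0.
  - by rewrite big_seq1 eqxx.
have /choice[m mP] : forall i, exists m, coset_eq Gamma0 (g m) (h i).
  by move=> i; apply/gP; exists (b i); rewrite ?basis_neq0.
have b_iso' i : isotypic VG (g (m i)) (b i).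
  have [t [w [tS wS bE]]] := b_iso i; exists t, w; split=> // x /tS xS.
  exact: coset_eq_trans (mP i) xS.
have mI : injective m.
  move=> i j mij; apply/eqP/contraT => ij.
  have [e [_ /(_ ord0)[u ue] eB]] := g1 (m i).
  have mult l : m l = m i ->
      exists x y, [/\ b l = ract (e ord0) x, x * y = 1 & y * x = 1].
    move=> ml; have := b_iso' l; rewrite ml => /eB[c [bE _]].
    rewrite big_ord1 in bE.
    (* Only this component of the coordinate contributes to the homogeneous [b l]; being homogeneous
       and nonzero, it is invertible. *)
    pose x := proj (hcomp0 Gamma0) (hcomp_direct Gamma0)
      (c ord0) (u^-1 * h l)%g.
    have xE : b l = ract (e ord0) x.
      by rewrite -(proj_ract _ _ ue) -bE proj_id //; exact: mcompB.
    have x0 : x != 0.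
      by apply: contra (basis_neq0 l) => /eqP x0; rewrite xE x0 raddf0.
    have [y [xy yx]] := hD
      (proj_in (hcomp0 Gamma0) (hcomp_direct Gamma0) (c ord0) _) x0.
    by exists x, y.
  have [x [y [ix xy _]]] := mult i erefl.
  have [x' [y' [jx' _ _]]] := mult j (esym mij).
  (* Both vectors are multiples of [e ord0], the first by the unit [x], so [b j] would be a multiple
     of [b i]. *)
  case: (@basis_not_multiple i j (y * x') ij).
  by rewrite ix ractA mulrA xy mul1r.
move=> i j a l ij ne cos; apply: (@fine (m i) (m j) (m a) (m l)).
- by rewrite (inj_eq mI).
- by apply: contra ne => /eqP[/mI-> /mI->].
apply: coset_eq_trans (coset_eq_div (mP i) (mP j)) _.
apply: coset_eq_trans cos _.
by apply: coset_eq_div; apply: coset_eq_sym.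
Qed.

End HomogeneousBasis.

(** * Endomorphisms as matrices over [D] *)

Section MatrixEntries.
Variables (G : groupType) (F : fieldType) (D : algType F).
Variables (Gamma0 : grading G D) (V : lmodType D^c).
Variables (VG : module_grading Gamma0 V) (V0 : exists v : V, v != 0).
Variables (k : nat) (dimV : graded_dim VG setT k).
Variables (b : 'I_k -> V) (h : 'I_k -> G) (c : V -> 'I_k -> D).
Hypothesis b_homog : forall i, VG (h i) (b i).
Hypothesis coordK : forall v, v = \sum_i ract (b i) (c v i).
Hypothesis coord_uniq : forall v x, v = \sum_i ract (b i) (x i) -> c v =1 x.

Local Notation R := (right_end V0).

Lemma coordZD a v w i : c (a *: v + w) i = c v i * (a : D) + c w i.
Proof.
apply: (@coord_uniq _ (fun i => c v i * (a : D) + c w i)).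
rewrite {1}[v]coordK {1}[w]coordK scaler_sumr -big_split.
apply: eq_bigr => j _ /=.
by rewrite /ract scalerDl scalerA.
Qed.

Lemma coordD v w i : c (v + w) i = c v i + c w i.
Proof. by have := coordZD 1 v w i; rewrite scale1r mulr1. Qed.

Lemma coord0 i : c 0 i = 0.
Proof.
by apply: (@coord_uniq 0 (fun=> 0)); rewrite big1 // => j _; apply: raddf0.
Qed.

Lemma coord_ract v a i : c (ract v a) i = c v i * a.
Proof. by have := coordZD a v 0 i; rewrite addr0 coord0 addr0. Qed.

Lemma coord_sum I (s : seq I) (w : I -> V) i :
  c (\sum_(l <- s) w l) i = \sum_(l <- s) c (w l) i.
Proof.
exact: (big_morph (fun v => c v i) (fun x y => coordD x y i) (coord0 i)).
Qed.

Lemma coord_basis i j : c (b j) i = (i == j)%:R.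
Proof.
apply: (@coord_uniq _ (fun i => (i == j)%:R)).
rewrite (bigD1 j) //= eqxx ract1 big1 ?addr0 // => l /negbTE->; exact: raddf0.
Qed.

(** Projecting each coordinate to this degree gives another expansion of [v]; uniqueness identifies
    the two. *)
Lemma coord_homog u v i : VG u v -> Gamma0 ((h i)^-1 * u)%g (c v i).
Proof.
move=> uv; rewrite (@coord_uniq v (fun i => proj (hcomp0 Gamma0)
  (hcomp_direct Gamma0) (c v i) ((h i)^-1 * u)%g)); first exact: proj_in.
have vB := @mcompB _ _ _ _ _ VG.
rewrite -{1}(proj_id (mcomp0 VG) vB (mcomp_direct VG) uv) {1}[v in LHS]coordK.
by rewrite (proj_sum _ vB); apply: eq_bigr => j _; apply: proj_ract.
Qed.

Definition entry (r : R) (i j : 'I_k) : D := c (r (b j)) i.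

Definition of_entries_fun (m : 'I_k -> 'I_k -> D) (v : V) : V :=
  \sum_i ract (b i) (\sum_j m i j * c v j).

Lemma of_entries_linear m : linear (of_entries_fun m).
Proof.
move=> a v w; rewrite /of_entries_fun scaler_sumr -big_split.
apply: eq_bigr => i _ /=.
have -> x : a *: ract (b i) x = ract (b i) (x * (a : D)).
  by rewrite /ract scalerA.
rewrite -raddfD; congr (ract _ _); rewrite mulr_suml -big_split.
apply: eq_bigr => j _ /=.
by rewrite coordZD mulrDr mulrA.
Qed.

HB.instance Definition _ m := GRing.isLinear.Build D^c V V _
  (of_entries_fun m) (of_entries_linear m).

Definition of_entries (m : 'I_k -> 'I_k -> D) : R :=
  of_entries_fun m : {linear V -> V}.

Lemma entry_of_entries m i j : entry (of_entries m) i j = m i j.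
Proof.
rewrite /entry (@coord_uniq _ (fun i => \sum_l m i l * c (b j) l)) //.
rewrite (bigD1 j) //= big1 => [|l lj]; rewrite coord_basis.
  by rewrite eqxx mulr1 addr0.
by rewrite (negbTE lj) mulr0.
Qed.

Lemma right_end_basis (r : R) (x : 'I_k -> D) :
  r (\sum_i ract (b i) (x i)) = \sum_i ract (r (b i)) (x i).
Proof. by rewrite raddf_sum; apply: eq_bigr => i _; apply: linearZZ. Qed.

Lemma entry_inj r s : (forall i j, entry r i j = entry s i j) -> r = s.
Proof.
move=> rs; apply: right_endP => v; rewrite [v]coordK !right_end_basis.
apply: eq_bigr => j _; congr (ract _ _).
by rewrite [LHS]coordK [RHS]coordK; apply: eq_bigr => i _; rewrite [c _ _]rs.
Qed.

Lemma entryZD (a : F) (r s : R) i j :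
  entry (a *: r + s) i j = a *: entry r i j + entry s i j.
Proof.
rewrite /entry -[(a *: r + s : R) _]/(ract (r (b j)) a%:A + s (b j)).
by rewrite coordD coord_ract mulr_algr.
Qed.

Lemma entry1 i j : entry 1 i j = (i == j)%:R.
Proof. exact: coord_basis. Qed.

Lemma entryM r s i j : entry (r * s) i j = \sum_l entry r i l * entry s l j.
Proof.
rewrite /entry -[(r * s : R) _]/(r (s (b j))) {1}[s (b j)]coordK right_end_basis.
by rewrite coord_sum; apply: eq_bigr => l _; rewrite coord_ract.
Qed.

(** Degrees can be tested on the basis: [r] must send b_j into degree g h_j, whose i-th coordinate
    has degree h_i^-1 g h_j. *)
Lemma entry_homogP g r :
  end_grading V0 dimV g r <->
  forall i j, Gamma0 ((h i)^-1 * g * h j)%g (entry r i j).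
Proof.
have -> : end_grading V0 dimV g = end_comp VG g by [].
split=> [gr i j|gr u v uv].
  by rewrite -mulgA; apply: coord_homog; apply: gr.
rewrite [v]coordK right_end_basis; apply: mcomp_sum => j _.
rewrite [r _]coordK ract_sum; apply: mcomp_sum => i _.
have -> : (g * u = h i * ((h i)^-1 * g * h j) * ((h j)^-1 * u))%g.
  by rewrite !mulgA mulgV mul1g mulgK.
by apply: mcompM; [apply: mcompM (b_homog i) (gr i j)|apply: coord_homog].
Qed.

End MatrixEntries.

Theorem proposition16 (G : groupType)
    (hG : forall g h : G, (g * h)%g = (h * g)%g)
    (F : fieldType) (D : algType F)
    (Gamma0 : grading G D) (hD : graded_division Gamma0)
    (V : lmodType D^c) (VG : module_grading Gamma0 V)
    (V0 : exists v : V, v != 0)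
    (k : nat) (dimV : graded_dim VG setT k)
    (fineDV : fine_condition VG) :
  let abT := support_group_comm (hD := hD) hG in
  isomorphic (quotient_group (diag_subgroup abT k))
             {ffun 'I_k.-1 -> support_group hD} /\
  isomorphic (weyl_group (end_grading V0 dimV))
             (sdprod_group (power_mod_diag_action abT k (weyl_action hD))).
Proof.
move=> abT; have [b [_ /choice[h b_homog] bB]] := dimV.
have b_basis v : exists! c : {ffun 'I_k -> D}, v = \sum_i ract (b i) (c i).
  by apply: bB.
have [c [coordK coord_uniq]] := basis_coordinates b_basis.
have [v v0] := V0.
(* An empty basis would make every vector zero; positivity supplies the base index [i0]. *)
have k0 : (0 < k)%N.
  rewrite lt0n; apply: contra_neq v0 => k0.
  by rewrite [v]coordK big1 // => i; have := ltn_ord i; rewrite {2}k0.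
split; first exact: power_mod_diag_isomorphic.
exact: (weyl_group_isomorphic hG hD (Ordinal k0)
  (basis_fine hG hD b_homog b_basis fineDV)
  (entry_of_entries V0 coordK coord_uniq) (entry_inj coordK)
  (entryZD coordK coord_uniq)
  (entry1 V0 coord_uniq) (entryM coordK coord_uniq)
  (entry_homogP dimV b_homog coordK coord_uniq)).
Qed.
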